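(* Let $N,n\ge 1$ be integers, $T>0$, $\lambda>0$, $\xi\in\mathbb{R}^n$, $A_1,\dots,A_N\in\mathbb{R}^{n\times n}$, and let $Q\in\mathbb{R}^{n\times n}$ be positive definite. Let $\psi:\mathbb{R}^N\to\mathbb{R}$ satisfy: (1) there exist measurable functions $\psi_i:\mathbb{R}\to\mathbb{R}$, $i=1,\dots,N$, such that $\psi(u)=\sum_{i=1}^N\psi_i(u_i)$ for all $u=[u_1,\dots,u_N]^\top\in\mathbb{R}^N$; (2) $\psi_i(0)=\psi_i(1)=0$ for all $i$; (3) $\psi_i(s)>0$ for all $s\in(0,1)$ and all $i$. Then any optimal solution $u^\ast$ to the relaxed problem (defined in the context) satisfies, for almost all $t\in[0,T]$, $$u_i^\ast(t)\in\{0,1\}\quad\text{for all } i\in\{1,\dots,N\},\qquad \sum_{i=1}^N u_i^\ast(t)=1.$$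
   Context: Controls are measurable functions $u=[u_1,\dots,u_N]^\top$ from $[0,T]$ to $\mathbb{R}^N$. Put $\Phi(x)=[A_1x,A_2x,\dots,A_Nx]\in\mathbb{R}^{n\times N}$ for $x\in\mathbb{R}^n$, and $$\mathcal{U}=\left\{u\in\mathbb{R}^N: u_i\in[0,1]\ (i=1,\dots,N),\ \sum_{i=1}^N u_i=1\right\}.$$ The relaxed problem is: find a control $u$ that solves $$\begin{aligned}&\underset{u}{\text{minimize}} && x(T)^\top Qx(T)+\lambda\int_0^T\psi(u(t))\,dt\\ &\text{subject to} && \dot x(t)=\Phi(x(t))u(t)=\sum_{i=1}^N A_ix(t)u_i(t),\quad x(0)=\xi,\\ &&& u(t)\in\mathcal{U}\ \text{ for almost all } t\in[0,T].\end{aligned}$$ Here $x:[0,T]\to\mathbb{R}^n$ is the (absolutely continuous) state trajectory generated by $u$, satisfying the differential equation for almost all $t$. An optimal solution is a feasible control attaining the minimum over all feasible controls. *)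

(* Defs.v *)
From HB Require Import structures.
From mathcomp Require Import all_boot all_order all_algebra.
From mathcomp Require Import all_classical all_reals all_analysis.
Set Implicit Arguments.
Unset Strict Implicit.
Unset Printing Implicit Defensive.
Import Order.TTheory GRing.Theory Num.Theory.
Import numFieldNormedType.Exports.
Local Open Scope classical_set_scope.
Local Open Scope ring_scope.

(* R with the sigma-algebra of Lebesgue (rather than Borel) measurable sets;
   it is the domain of [completed_lebesgue_measure].  R itself, as a codomain,
   carries the Borel sigma-algebra. *)
Notation lebesgueTypeR R := (caratheodory_type ((@wlength R idfun)^*)%mu).

(* Symmetry of [Q] is not required. *)
Definition posdefmx (R : realType) (n : nat) (Q : 'M[R]_n) : Prop :=
  forall x : 'cV[R]_n, x != 0 -> 0 < (x^T *m Q *m x) 0 0.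

Definition abs_continuous (R : realType) (V : normedModType R)
    (a b : R) (f : R -> V) : Prop :=
  forall e : R, 0 < e -> exists2 d : R, 0 < d &
    forall (k : nat) (l r : 'I_k -> R),
      (forall j, [/\ a <= l j, l j <= r j & r j <= b]) ->
      trivIset setT (fun j => `]l j, r j[%classic) ->
      \sum_(j < k) (r j - l j) < d ->
      \sum_(j < k) `|f (r j) - f (l j)| < e.

Definition Phi (R : realType) (n N : nat) (A : 'I_N -> 'M[R]_n)
    (x : 'cV[R]_n) : 'M[R]_(n, N) :=
  \matrix_(k < n, i < N) (A i *m x) k 0.

Definition ctrl_set (R : realType) (N : nat) : set 'cV[R]_N :=
  [set u | (forall i, 0 <= u i 0 <= 1) /\ \sum_(i < N) u i 0 = 1].

(* Only the values of controls and trajectories on [0, T] are relevant. *)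
Definition trajectory (R : realType) (n N : nat) (T : R)
    (A : 'I_N -> 'M[R]_n) (xi : 'cV[R]_n)
    (u : R -> 'cV[R]_N) (x : R -> 'cV[R]_n) : Prop :=
  [/\ abs_continuous 0 T x,
      x 0 = xi &
      \forall t \ae (@completed_lebesgue_measure R),
        0 <= t <= T -> is_derive (t : R) 1 x (Phi A (x t) *m u t)].

Definition feasible (R : realType) (N : nat) (T : R) (u : R -> 'cV[R]_N)
    : Prop :=
  (forall i, measurable_fun (`[0, T]%classic : set (lebesgueTypeR R))
               (fun t : lebesgueTypeR R => (u t i 0 : R))) /\
  (\forall t \ae (@completed_lebesgue_measure R),
     0 <= t <= T -> ctrl_set (u t)).

(* The cost may be +oo: psi is only assumed measurable. *)
Definition cost (R : realType) (n N : nat) (T lambda : R) (Q : 'M[R]_n)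
    (psi : 'cV[R]_N -> R) (u : R -> 'cV[R]_N) (x : R -> 'cV[R]_n) : \bar R :=
  (((((x T)^T *m Q *m x T) 0 0)%R)%:E +
   lambda%:E * \int[@completed_lebesgue_measure R]_(t in `[0%R, T])
                 (psi (u t))%:E)%E.

Definition optimal (R : realType) (n N : nat) (T lambda : R)
    (xi : 'cV[R]_n) (A : 'I_N -> 'M[R]_n) (Q : 'M[R]_n)
    (psi : 'cV[R]_N -> R) (u : R -> 'cV[R]_N) : Prop :=
  feasible T u /\
  exists2 x, trajectory T A xi u x &
    forall v y, feasible T v -> trajectory T A xi v y ->
      (cost T lambda Q psi u x <= cost T lambda Q psi v y)%E.

(* Main.v *)
Require Import Defs.
From HB Require Import structures.
From mathcomp Require Import all_boot all_order all_algebra.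
From mathcomp Require Import all_classical all_reals all_analysis.
From mathcomp Require Import measurable_realfun ring lra.
Set Implicit Arguments.
Unset Strict Implicit.
Unset Printing Implicit Defensive.
Import Order.TTheory GRing.Theory Num.Theory.
Import numFieldNormedType.Exports.
Local Open Scope classical_set_scope.
Local Open Scope ring_scope.

(** The running cost vanishes exactly at the vertices of the simplex of
    controls, while the terminal cost depends smoothly on the control through a
    linear differential equation. Let [u] be optimal, [x] its trajectory,
    [B = \sum_k u_k A_k], and let [p] solve the adjoint equation
    [p' = - B^T p] with [p(T) = (Q + Q^T) x(T)]. Replacing [u] by the vertex
    [e_k] on a set [S] of measure [delta] (a needle variation) changes the
    terminal cost by at most

      (integral over [S] of [p^T (A_k - B) x]) [+ C * delta ^ 2],

    where [C] does not depend on [S] or [k]; [needle_variation] states this for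
    a nonpositive integrand. The average of [p^T (A_k - B) x] over [k] with
    weights [u_k] is zero, so at every time some [k] makes it nonpositive
    ([some_switch_le0]). If moreover the running
    cost of [u] is at least [c] on [S], the replacement saves at least
    [lambda * c * delta] there ([integral_drop]). By optimality
    [lambda * c <= C * delta] unless [delta = 0], so a set [S] of this kind
    that is short enough is null ([needle_balance]). The times at which [u] is
    not a vertex are covered by countably many such sets, indexed by the vertex
    [k], by a lower bound [c] and by a short time interval, hence they form a
    null set.

    Three facts about measurable data carry this argument. An absolutely
    continuous function with a nonpositive derivative almost everywhere does
    not increase ([ac_nonincreasing]); all estimates compare two functions
    through their derivatives in this way, instead of manipulating integrals.
    Linear systems with bounded measurable coefficients have Lipschitz
    solutions ([linear_ode], [adjoint_ode]); this provides both the competing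
    trajectories and the adjoint state. Finally, indefinite integrals are
    differentiated for Borel integrands, so the Lebesgue measurable control is
    first replaced by a Borel one equal to it almost everywhere
    ([borel_control]). *)

(** * Lebesgue and Borel measurability *)

#[local] Instance ae_lebesgue_filter (R : realType) :
  Filter (almost_everywhere (@lebesgue_measure R)).
Proof. exact: (ae_filter_ringOfSetsType (@lebesgue_measure R)). Qed.

Lemma borel_completed_measurable (R : realType) (A : set R) :
  measurable (A : set (measurableTypeR R)) ->
  measurable (A : set (lebesgueTypeR R)).
Proof. exact: sub_caratheodory. Qed.

(** Every set of the completion is a Borel set together with a subset of a null
    set; keeping the Borel part yields an approximation from inside. *)
Lemma completed_inner_borel (R : realType) (E : set R) :
  measurable (E : set (lebesgueTypeR R)) ->
  exists2 A : set R, measurable (A : set (measurableTypeR R)) /\ A `<=` E &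
    (@lebesgue_measure R).-negligible (E `\` A).
Proof.
move=> mE.
have : measurable_realfun.completed_algebra_gen (@lebesgue_measure R) E.
  by rewrite -g_sigma_completed_algebra_genE completed_caratheodory_measurable.
move=> [A mA [N negN <-]]; exists A; first by split => //; exact: subsetUl.
by apply: negligibleS negN => t [[]].
Qed.

Lemma negligible_completedE (R : realType) (E : set R) :
  (@completed_lebesgue_measure R).-negligible E <->
  (@lebesgue_measure R).-negligible E.
Proof.
split=> -[A [mA A0 EA]].
- have [B [mB BA] nAB] := completed_inner_borel mA.
  have EB : E `<=` B `|` (A `\` B).
    by move=> t /EA At; have [Bt|nBt] := pselect (B t); [left|right].
  apply: (@negligibleS _ _ _ (@lebesgue_measure R) _ _ EB); apply: (negligibleU _ nAB).
  apply/negligibleP => //; apply/eqP; rewrite eq_le measure_ge0 andbT -A0.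
  exact: le_outer_measure.
- by exists A; split => //; exact: borel_completed_measurable.
Qed.

Lemma ae_completedE (R : realType) (P : R -> Prop) :
  (\forall t \ae (@completed_lebesgue_measure R), P t) <->
  (\forall t \ae (@lebesgue_measure R), P t).
Proof. exact: negligible_completedE. Qed.

(** The superlevel sets of [f] at rational levels are Borel up to null sets;
    only countably many levels are involved, so a Borel function can be rebuilt
    from Borel approximations of them. *)
Lemma borel_version (R : realType) (D : set R) (f : R -> R) :
  measurable (D : set (measurableTypeR R)) ->
  measurable_fun (D : set (lebesgueTypeR R)) (f : lebesgueTypeR R -> R) ->
  exists2 g : R -> R, measurable_fun setT (g : measurableTypeR R -> R) /\
      (forall t, 0 <= g t <= 1) &
    \forall t \ae (@lebesgue_measure R), D t -> 0 <= f t <= 1 -> g t = f t.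
Proof.
move=> mD mf.
have mDc := borel_completed_measurable mD.
pose q (k : nat) : R := if @unpickle rat k is Some r then ratr r else 0.
(* [A k] approximates the superlevel set of [f] at the [k]-th rational from inside. *)
have hA k : exists A : set R, [/\ measurable (A : set (measurableTypeR R)),
    A `<=` D `&` [set t | q k < f t] &
    (@lebesgue_measure R).-negligible ((D `&` [set t | q k < f t]) `\` A)].
  have [|A [mA AD] nA] := @completed_inner_borel R (D `&` [set t | q k < f t]).
    have := mf mDc `]q k, +oo[%classic (measurable_itv _).
    by congr (measurable (_ `&` _)); apply/seteqP; split => t /=; rewrite in_itv/= andbT.
  by exists A.
have [A hA'] := choice hA.
(* Truncating the levels to [0, 1] keeps the supremum below between 0 and 1. *)
pose c k : R := if q k < 0 then 0 else if 1 < q k then 1 else q k.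
have c01 k : 0 <= c k <= 1 by rewrite /c; case: ltP; case: ltP; lra.
pose h k t := c k * \1_(A k) t.
have h01 k t : 0 <= h k t <= 1.
  by rewrite /h indicE; case: (t \in A k); have := c01 k; rewrite ?mulr1 ?mulr0; lra.
have hub t : has_ubound (range (h^~ t)).
  by exists 1 => _ [k _ <-]; have := h01 k t; lra.
have hs t : has_sup [set h n t | n in [set n | (0 <= n)%N]].
  split; first by exists (h 0%N t); exists 0%N.
  by exists 1 => _ [k _ <-]; have := h01 k t; lra.
exists (fun t => sups (h^~ t) 0%N); first split.
- apply: measurable_fun_sups => [t _|k]; first exact: hub.
  apply: measurable_funM; first exact: measurable_cst.
  by apply: measurable_indic; have [] := hA' k.
- move=> t; rewrite /sups/= /sdrop.
  apply/andP; split.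
    apply: (@le_trans _ _ (h 0%N t)); first by have := h01 0%N t; lra.
    by apply: ub_le_sup; [exact: (hs t).2|exists 0%N].
  by apply: ge_sup; [exact: (hs t).1|move=> _ [k _ <-]; have := h01 k t; lra].
- have : \forall t \ae (@lebesgue_measure R), forall k,
      ~ ((D `&` [set t | q k < f t]) `\` A k) t.
    apply: ae_foralln => k; have [_ _] := hA' k.
    by apply: negligibleS => t /= /contrapT.
  apply: filterS => t hk Dt ft.
  rewrite /sups/= /sdrop.
  apply/eqP; rewrite eq_le; apply/andP; split.
    apply: ge_sup; [exact: (hs t).1|move=> _ [k _ <-]].
    rewrite /h indicE; have [/set_mem tA|] := boolP (t \in A k); last by rewrite mulr0; lra.
    have [_ /(_ _ tA) [_ /= qf] _] := hA' k.
    by rewrite mulr1 /c; case: ltP; case: ltP; lra.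
  rewrite leNgt; apply/negP => sf.
  have [r] := rat_in_itvoo sf; rewrite in_itv/= => /andP[sr rf].
  have qr : q (pickle r) = ratr r by rewrite /q pickleK.
  have tA : A (pickle r) t.
    by apply: contrapT => nA; apply: (hk (pickle r)); split => //=; rewrite qr.
  have := ub_le_sup (hs t).2 (ex_intro2 _ _ (pickle r) isT erefl).
  rewrite /h indicE mem_set// mulr1 /c qr.
  have : 0 <= sup [set h n t | n in [set n | (0 <= n)%N]].
    apply: le_trans (ub_le_sup (hs t).2 (ex_intro2 _ _ 0%N isT erefl)).
    by have := h01 0%N t; lra.
  by case: ltP; case: ltP; move: sr rf; lra.
Qed.

(** * Absolutely continuous functions with a nonpositive derivative *)

Definition chain_increment (R : realType) (f : R -> R) (s : seq (R * R)) : R :=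
  \sum_(p <- s) (f p.2 - f p.1).

(** The intervals of a chain are listed from left to right; together with the
    bounds [l] and [r] this is what makes two chains on adjacent intervals
    concatenate to a chain. *)
Definition chain (R : realType) (U : set R) (l r : R) (s : seq (R * R)) : Prop :=
  all (fun p => [&& l <= p.1, p.1 <= p.2 & p.2 <= r]) s /\
  pairwise (fun p q : R * R => p.2 <= q.1) s /\
  (forall p, p \in s -> `]p.1, p.2[%classic `<=` U).

(** The growth of [f] from [l] to [r] is paid for by the slope [e], except on
    finitely many intervals inside [U]. The set [U] will be a small open
    neighbourhood of the times at which the derivative is not controlled. *)
Definition straddled (R : realType) (f : R -> R) (U : set R) (e l r : R) : Prop :=
  exists2 s, chain U l r s & f r - f l <= e * (r - l) + chain_increment f s.

Lemma chain_nil (R : realType) (U : set R) l r : chain U l r [::].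
Proof. by split; [|split]. Qed.

Lemma straddled_cat (R : realType) (f : R -> R) (U : set R) e l m r :
  l <= m -> m <= r -> straddled f U e l m -> straddled f U e m r ->
  straddled f U e l r.
Proof.
move=> lm mr [s [/allP s1 [s2 s3]] s4] [s' [/allP s1' [s2' s3']] s4'].
exists (s ++ s'); last first.
  by rewrite /chain_increment big_cat/=; move: s4 s4'; rewrite /chain_increment; lra.
split; [|split].
- apply/allP => p; rewrite mem_cat => /orP[/s1|/s1'] /and3P[h1 h2 h3];
  apply/and3P; split; lra.
- rewrite pairwise_cat s2 s2' !andbT; apply/allrelP => p q /s1 /and3P[_ _ h] /s1' /and3P[h' _ _].
  exact: le_trans h h'.
- by move=> p; rewrite mem_cat => /orP[/s3|/s3'].
Qed.

(** Cousin's argument: a property of intervals that is additive and holds on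
    all small intervals around each point holds on the whole interval. *)
Lemma straddled_local (R : realType) (f : R -> R) (U : set R) (e a b : R) :
  a <= b ->
  (forall t, a <= t <= b -> exists2 d, 0 < d &
     forall l r, l <= t <= r -> t - d < l -> r < t + d -> a <= l -> r <= b ->
       straddled f U e l r) ->
  straddled f U e a b.
Proof.
move=> ab loc.
(* The supremum of [S] belongs to [S], and [S] extends past it unless it is [b]. *)
pose S := [set c | a <= c <= b /\ straddled f U e a c].
have Sa : S a.
  split; first by rewrite lexx.
  by exists [::]; [exact: chain_nil|rewrite /chain_increment big_nil; lra].
have hS : has_sup S by split; [exists a|exists b => c [/andP[]]].
have aS : a <= sup S by apply: ub_le_sup => //; exact: hS.2.
have Sb : sup S <= b by apply: ge_sup; [exact: hS.1|move=> c [/andP[]]].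
have [|d d0 hd] := loc (sup S); first by rewrite aS.
have [c [/andP[ac cb] Sc] cS] := sup_adherent d0 hS.
have cleS : c <= sup S by apply: ub_le_sup; [exact: hS.2|split => //; rewrite ac].
pose r := if b < sup S + d / 2 then b else sup S + d / 2.
have [rS rd rb] : [/\ sup S <= r, r < sup S + d & r <= b].
  by rewrite /r; case: ltP => h; split; lra.
have Sr : straddled f U e a r.
  apply: (straddled_cat ac _ Sc); first lra.
  by apply: hd; lra.
have : r <= sup S by apply: ub_le_sup; [exact: hS.2|split => //; lra].
move: Sr; rewrite {}/r in rS rd rb *; case: ltP => //; lra.
Qed.

Lemma chain_length (R : realType) (U : set R) (l r : R) (s : seq (R * R)) :
  open U -> chain U l r s ->
  ((\sum_(p <- s) (p.2 - p.1))%:E <= @lebesgue_measure R U)%E.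
Proof.
move=> oU; elim: s l U oU => [|p s IH] l U oU [/=].
  by rewrite big_nil measure_ge0.
move=> /andP[/and3P[lp pp pr] /allP hs] [/andP[/allP ps sp] sU].
(* The leftmost interval is split off from [U]; the others lie to its right, in [W]. *)
pose V := `]p.1, p.2[%classic; pose W := U `&` `]p.2, +oo[%classic.
have oW : open W by apply: openI => //; exact: interval_open.
have VW : V `&` W = set0.
  by apply/seteqP; split => // t []; rewrite /V /W/= !in_itv/= => /andP[_ h1] [_ /andP[h2 _]]; lra.
have mW := open_measurable oW.
have VWU : V `|` W `<=` U by rewrite subUset; split; [apply: sU; rewrite mem_head|exact: subIsetl].
rewrite big_cons EFinD.
apply: (@le_trans _ _ (@lebesgue_measure R (V `|` W))); last first.
  by apply: le_outer_measure.
rewrite measureU//; last exact: measurable_itv.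
apply: leeD.
  have EV : @lebesgue_measure R V = (p.2 - p.1)%:E.
    rewrite /V lebesgue_measure_itv/= lte_fin; case: ltP => [_|h]; first by rewrite EFinB.
    by congr _%:E; lra.
  by rewrite -EV.
apply: (IH p.2) => //; split; [|split] => //.
  by apply/allP => q qs; have /and3P[_ h1 h2] := hs _ qs; apply/and3P; split => //; exact: ps.
move=> q qs t tq; split; first by apply: (sU q) => //; rewrite in_cons qs orbT.
have := ps _ qs; move: tq; rewrite /= !in_itv/= andbT => /andP[h1 _]; lra.
Qed.

(** Absolute continuity applied to the intervals of the chain: their total
    length is at most the measure of [U]. *)
Lemma chain_increment_le (R : realType) (f : R -> R) (a b e d : R) (U : set R) s :
  (forall (k : nat) (l r : 'I_k -> R),
      (forall j, [/\ a <= l j, l j <= r j & r j <= b]) ->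
      trivIset setT (fun j => `]l j, r j[%classic) ->
      \sum_(j < k) (r j - l j) < d ->
      \sum_(j < k) `|f (r j) - f (l j)| < e) ->
  open U -> (@lebesgue_measure R U < d%:E)%E -> chain U a b s ->
  chain_increment f s <= e.
Proof.
move=> hd oU Ud cs; have [/allP s1 [s2 s3]] := cs.
have sd : \sum_(p <- s) (p.2 - p.1) < d.
  by rewrite -lte_fin; apply: le_lt_trans (chain_length oU cs) Ud.
pose z : R * R := (0, 0).
have -> : chain_increment f s = \sum_(j < size s) (f (nth z s j).2 - f (nth z s j).1).
  by rewrite /chain_increment (big_nth z) big_mkord.
apply: (@le_trans _ _ (\sum_(j < size s) `|f (nth z s j).2 - f (nth z s j).1|)).
  by apply: ler_sum => j _; exact: ler_norm.
apply/ltW/hd.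
- by move=> j; have /and3P[] := s1 _ (mem_nth z (ltn_ord j)).
- have key (i j : 'I_(size s)) : (i < j)%N -> (nth z s i).2 <= (nth z s j).1.
    by move=> ij; apply: (pairwiseP z s2) => //; rewrite inE.
  move=> i j _ _ [t []]/=; rewrite !in_itv/= => /andP[h1 h2] /andP[h3 h4].
  apply/eqP; rewrite -val_eqE/=; case: ltngtP => // /key; lra.
- by move: sd; rewrite (big_nth z) big_mkord.
Qed.

Lemma derive_le0_straddle (R : realType) (f : R -> R) (t df e : R) :
  is_derive t 1 f df -> df <= 0 -> 0 < e ->
  exists2 d, 0 < d & forall l r, l <= t <= r -> t - d < l -> r < t + d ->
    f r - f l <= e * (r - l).
Proof.
move=> [dv dfE] df0 e0.
have /cvgrPdist_le/(_ _ e0) : h^-1 *: (f (h *: 1 + t) - f t) @[h --> 0^'] --> df.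
  by rewrite -dfE; exact: dv.
move=> /nbhs_ballP [d /= d0 hd].
exists d => // l r /andP[lt tr] dl dr.
have key h : h != 0 -> `|h| < d -> `|df - h^-1 * (f (h + t) - f t)| <= e.
  move=> h0 hh; have := hd h; rewrite /ball/= sub0r normrN => /(_ hh h0).
  by rewrite /= [_ *: 1]mulr1.
have fr : f r - f t <= e * (r - t).
  have [->|rt] := eqVneq r t; first lra.
  have rt0 : 0 < r - t by rewrite subr_gt0 lt_neqAle eq_sym rt.
  have := key (r - t) (lt0r_neq0 rt0); rewrite gtr0_norm// subrK => /(_ ltac:(lra)).
  rewrite ler_norml => /andP[h _].
  have : (r - t)^-1 * (f r - f t) <= e by lra.
  by rewrite mulrC ler_pdivrMr.
have fl : f t - f l <= e * (t - l).
  have [->|rt] := eqVneq l t; first lra.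
  have rt0 : 0 < t - l by rewrite subr_gt0 lt_neqAle rt.
  have := key (l - t) ltac:(lra); rewrite subrK distrC gtr0_norm// => /(_ ltac:(lra)).
  rewrite ler_norml => /andP[h _].
  have : (l - t)^-1 * (f l - f t) <= e by lra.
  by rewrite -(opprB t l) -(opprB (f t) (f l)) invrN mulrNN mulrC ler_pdivrMr.
by lra.
Qed.

(** The exceptional null set is enclosed in an open set [U] so small that
    absolute continuity bounds the growth over intervals inside [U] by [e]. At
    any other point [f] grows locally with slope at most [e]. Chaining the two
    kinds of intervals gives [f b - f a <= e * (b - a) + e]. *)
Lemma ac_nonincreasing (R : realType) (f : R -> R) (a b : R) :
  a <= b -> abs_continuous a b f ->
  (\forall t \ae (@lebesgue_measure R), a <= t <= b ->
     exists2 df, is_derive (t : R) 1 f df & df <= 0) ->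
  f b <= f a.
Proof.
move=> ab acf [Z [mZ Z0 hZ]].
apply/ler_addgt0Pr => e0 e00.
(* Chosen so that the two error terms [e * (b - a)] and [e] add up to [e0]. *)
pose e := e0 / (b - a + 1).
have e_gt0 : 0 < e by rewrite divr_gt0//; lra.
have [d d0 hd] := acf e e_gt0.
have {}Z0 : @lebesgue_measure R Z = 0%E := Z0.
have Zfin : (@lebesgue_measure R Z < +oo)%E by rewrite Z0.
have [U [oU ZU muU]] := lebesgue_regularity_outer mZ Zfin d0.
have Ud : (@lebesgue_measure R U < d%:E)%E.
  have mU := open_measurable oU.
  have -> : U = (U `\` Z) `|` Z by rewrite setUC setDUK.
  have -> : (@lebesgue_measure R ((U `\` Z) `|` Z) =
      @lebesgue_measure R (U `\` Z) + @lebesgue_measure R Z)%E.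
    by apply: measureU => //; [exact: measurableD|by apply/seteqP; split => // t [[]]].
  by move: muU; rewrite Z0 adde0.
have [s cs fs] : straddled f U e a b.
  apply: straddled_local => // t tab.
  have [Zt|nZt] := pselect (Z t).
    have /nbhs_ballP[r /= r0 rU] := open_nbhs_nbhs (conj oU (ZU _ Zt)).
    exists r => // l s /andP[lt ts] h1 h2 h3 h4.
    exists [:: (l, s)]; last by rewrite /chain_increment big_seq1/=; nra.
    split; [|split] => //=; first by rewrite !lexx (le_trans lt ts).
    move=> p; rewrite inE => /eqP -> x /=; rewrite in_itv/= => /andP[lx xs].
    by apply: rU; rewrite /ball/= ltr_norml; apply/andP; split; lra.
  have [df dft df0] : exists2 df, is_derive t 1 f df & df <= 0.
    by apply: contrapT => nd; apply: nZt; apply: hZ => /= /(_ tab).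
  have [r r0 hr] := derive_le0_straddle dft df0 e_gt0.
  exists r => // l s lts h1 h2 _ _.
  exists [::]; first exact: chain_nil.
  by rewrite /chain_increment big_nil addr0; exact: hr.
have := chain_increment_le hd oU Ud cs.
have : e * (b - a + 1) = e0 by rewrite /e mulfVK//; lra.
by move: fs; lra.
Qed.

(** * Lipschitz functions, their derivatives, and primitives *)

Notation der f t d := (is_derive (t%R : Real.sort _) 1%R f d).

Lemma derD (R : realType) (f g : R -> R) (t a b : R) :
  der f t a -> der g t b -> der (fun s => f s + g s) t (a + b).
Proof. exact: is_deriveD. Qed.

Lemma derN (R : realType) (f : R -> R) (t a : R) :
  der f t a -> der (fun s => - f s) t (- a).
Proof. exact: is_deriveN. Qed.

Lemma derM (R : realType) (f g : R -> R) (t a b : R) :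
  der f t a -> der g t b -> der (fun s => f s * g s) t (f t * b + g t * a).
Proof. exact: is_deriveM. Qed.

Lemma der_cst (R : realType) (c t : R) : der (fun _ : R => c) t 0.
Proof. exact: is_derive_cst. Qed.

Lemma der_id (R : realType) (t : R) : der (fun s : R => s) t 1.
Proof. exact: is_derive_id. Qed.

Lemma derZ (R : realType) (c : R) (f : R -> R) (t a : R) :
  der f t a -> der (fun s => c * f s) t (c * a).
Proof.
by move=> fa; have := derM (der_cst c t) fa; rewrite mulr0 addr0.
Qed.

Lemma der_sum (R : realType) n (f : 'I_n -> R -> R) (t : R) (a : 'I_n -> R) :
  (forall i, der (f i) t (a i)) ->
  der (fun s => \sum_(i < n) f i s) t (\sum_(i < n) a i).
Proof.
move=> /is_derive_sum h.
by rewrite (_ : (fun s => _) = \sum_(i < n) f i)//; apply/funext => s; rewrite fct_sumE.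
Qed.

Lemma der_expR (R : realType) (f : R -> R) (t a : R) :
  der f t a -> der (fun s => expR (f s)) t (expR (f t) * a).
Proof.
move=> fa; have := is_derive1_comp (is_derive_expR (f t)) fa.
by rewrite mulrC.
Qed.

(** On a bounded interval Lipschitz functions are closed under products and
    exponentials, and they are absolutely continuous; trajectories of bounded
    controls are of this kind. *)
Definition lip (R : realType) (a b : R) (f : R -> R) : Prop :=
  exists2 L, 0 <= L &
    forall s t, a <= s <= b -> a <= t <= b -> `|f s - f t| <= L * `|s - t|.

Lemma lip_bounded (R : realType) (a b : R) (f : R -> R) :
  lip a b f -> exists2 M, 0 <= M & forall t, a <= t <= b -> `|f t| <= M.
Proof.
move=> [L L0 h]; exists (`|f a| + L * `|b - a|).
  by rewrite addr_ge0// mulr_ge0.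
move=> t /andP[h1 h2].
have := h t a; rewrite h1 h2 lexx (le_trans h1 h2) => /(_ isT isT) h3.
have := ler_normD (f a) (f t - f a); rewrite subrKC => /le_trans; apply.
rewrite lerD2l; apply: (le_trans h3); apply: ler_wpM2l => //.
by rewrite !ger0_norm; lra.
Qed.

Lemma lip_sub (R : realType) (a b c d : R) (f : R -> R) :
  a <= c -> d <= b -> lip a b f -> lip c d f.
Proof.
move=> ac db [L L0 h]; exists L => // s t /andP[? ?] /andP[? ?].
by apply: h; apply/andP; split; lra.
Qed.

Lemma lip_cst (R : realType) (a b c : R) : lip a b (fun _ => c).
Proof. by exists 0 => // s t _ _; rewrite subrr normr0 mul0r. Qed.

Lemma lip_id (R : realType) (a b : R) : lip a b (fun t => t).
Proof. by exists 1 => // s t _ _; rewrite mul1r. Qed.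

Lemma lipD (R : realType) (a b : R) (f g : R -> R) :
  lip a b f -> lip a b g -> lip a b (fun t => f t + g t).
Proof.
move=> [L L0 hf] [K K0 hg]; exists (L + K); first exact: addr_ge0.
move=> s t hs ht; rewrite opprD addrACA mulrDl (le_trans (ler_normD _ _))//.
by apply: lerD; [exact: hf|exact: hg].
Qed.

Lemma lipM (R : realType) (a b : R) (f g : R -> R) :
  lip a b f -> lip a b g -> lip a b (fun t => f t * g t).
Proof.
move=> hf hg; have [F F0 bf] := lip_bounded hf; have [G G0 bg] := lip_bounded hg.
move: hf hg => [L L0 hf] [K K0 hg]; exists (F * K + G * L).
  by rewrite addr_ge0// mulr_ge0.
move=> s t hs ht.
have -> : f s * g s - f t * g t = f s * (g s - g t) + g t * (f s - f t) by ring.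
rewrite (le_trans (ler_normD _ _))// !normrM mulrDl -!mulrA; apply: lerD; apply: ler_pM => //.
- exact: bf.
- exact: hg.
- exact: bg.
- exact: hf.
Qed.

Lemma lipZ (R : realType) (a b c : R) (f : R -> R) :
  lip a b f -> lip a b (fun t => c * f t).
Proof. by apply: lipM; exact: lip_cst. Qed.

Lemma lipN (R : realType) (a b : R) (f : R -> R) :
  lip a b f -> lip a b (fun t => - f t).
Proof. by move=> [L L0 h]; exists L => // s t hs ht; rewrite -opprD normrN; exact: h. Qed.

Lemma lip_sum (R : realType) (a b : R) n (f : 'I_n -> R -> R) :
  (forall i, lip a b (f i)) -> lip a b (fun t => \sum_(i < n) f i t).
Proof.
move=> hf; elim: n f hf => [|n IH] f hf.
  rewrite (_ : (fun _ => _) = fun=> 0); first exact: lip_cst.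
  by apply/funext => t; rewrite big_ord0.
rewrite (_ : (fun _ => _) =
    fun t => \sum_(i < n) f (widen_ord (leqnSn n) i) t + f ord_max t).
  by apply: lipD => //; exact: IH.
by apply/funext => t; rewrite big_ord_recr.
Qed.

(** The inequality [1 + y <= expR y] bounds the increment of the exponential
    by its larger value times the increment of the argument. *)
Lemma lip_expR (R : realType) (a b : R) (f : R -> R) :
  lip a b f -> lip a b (fun t => expR (f t)).
Proof.
move=> hf; have [F F0 bf] := lip_bounded hf; move: hf => [L L0 hf].
exists (expR F * L); first by rewrite mulr_ge0// expR_ge0.
have key s t : a <= s <= b -> a <= t <= b -> f t <= f s ->
    expR (f s) - expR (f t) <= expR F * L * `|s - t|.
  move=> hs ht fts.
  have e1 := expR_ge1Dx (f t - f s).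
  have : expR (f s) * (1 - expR (f t - f s)) <= expR (f s) * (f s - f t).
    by rewrite ler_wpM2l ?expR_ge0//; lra.
  have -> : expR (f s) * (1 - expR (f t - f s)) = expR (f s) - expR (f t).
    by rewrite mulrBr mulr1 -expRD subrKC.
  move=> /le_trans; apply.
  rewrite -mulrA; apply: ler_pM => //; first lra.
    by rewrite ler_expR (le_trans (ler_norm _))// bf.
  by apply: le_trans (hf _ _ hs ht); exact: ler_norm.
move=> s t hs ht; have [fts|/ltW fst] := leP (f t) (f s).
  by rewrite ger0_norm ?subr_ge0 ?ler_expR//; exact: key.
by rewrite distrC (distrC s) ger0_norm ?subr_ge0 ?ler_expR//; exact: key.
Qed.

Lemma lip_ac (R : realType) (V : normedModType R) (a b L : R) (f : R -> V) :
  0 <= L ->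
  (forall s t, a <= s <= b -> a <= t <= b -> `|f s - f t| <= L * `|s - t|) ->
  abs_continuous a b f.
Proof.
move=> L0 h e e0; exists (e / (L + 1)); first by rewrite divr_gt0//; lra.
move=> k l r hlr _ sd.
have e1 : L * (e / (L + 1)) < e.
  by rewrite mulrA ltr_pdivrMr ?mulrDr; first nra; lra.
apply: le_lt_trans e1.
apply: (@le_trans _ _ (\sum_(j < k) L * (r j - l j))).
  apply: ler_sum => j _; have [h1 h2 h3] := hlr j.
  apply: le_trans (h _ _ _ _) _; [|lra|by rewrite ger0_norm//; lra].
  by apply/andP; split; lra.
by rewrite -mulr_sumr ler_wpM2l// ltW.
Qed.

(** The form in which derivatives are integrated below: almost everywhere
    comparison of the derivatives gives comparison of the increments. *)
Lemma lip_le (R : realType) (T : R) (f g : R -> R) :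
  lip 0 T f -> lip 0 T g ->
  (\forall t \ae (@lebesgue_measure R), 0 <= t <= T ->
     exists df dg, [/\ der f t df, der g t dg & df <= dg]) ->
  forall s t, 0 <= s -> s <= t -> t <= T -> f t - f s <= g t - g s.
Proof.
move=> lf lg hd s t s0 st tT.
have [L L0 h] : lip s t (fun x => f x + - g x).
  by apply: (lip_sub s0 tT); apply: lipD => //; exact: lipN.
suff : f t + - g t <= f s + - g s by lra.
apply: (@ac_nonincreasing R (fun x => f x + - g x)) => //; first exact: (lip_ac (V := R) L0).
apply: filterS hd => x hx /andP[sx xt].
have [|df [dg [h1 h2 h3]]] := hx; first by apply/andP; split; lra.
by exists (df + - dg); [exact: derD h1 (derN h2)|lra].
Qed.

(** For a bounded Borel [g] this is a Lipschitz function vanishing for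
    [t <= 0], with derivative [g] almost everywhere on [t >= 0]. *)
Definition prim (R : realType) (g : R -> R) (t : R) : R :=
  (\int[@lebesgue_measure R]_(s in `[0%R, t]) g s)%R.

Section prim.
Variables (R : realType) (g : R -> R) (M : R).
Hypotheses (mg : measurable_fun setT (g : measurableTypeR R -> R))
  (gM : forall t, `|g t| <= M).
Local Notation mu := (@lebesgue_measure R).

Let M0 : 0 <= M. Proof. exact: le_trans (gM 0). Qed.

Let int_bounded (D : set R) : measurable (D : set (measurableTypeR R)) ->
  (mu D < +oo)%E -> mu.-integrable D (EFin \o g).
Proof.
move=> mD fD; apply: measurable_bounded_integrable => //.
  exact: measurable_funS mg.
by exists M; split; [exact: num_real|move=> x Mx t _; exact: le_trans (gM t) (ltW Mx)].
Qed.

Let itv_fin (a b : R) (x y : bool) :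
  (mu [set` Interval (BSide x a) (BSide y b)] < +oo)%E.
Proof. by rewrite lebesgue_measure_itv/=; case: ifP => // _; rewrite -EFinB ltry. Qed.

Lemma prim_le0 t : t <= 0 -> prim g t = 0.
Proof.
rewrite le_eqVlt => /predU1P[->|t0]; first by rewrite /prim set_itv1 Rintegral_set1.
by rewrite /prim set_itv_ge ?Rintegral_set0// bnd_simp -ltNge.
Qed.

Let prim_lip0 s t : 0 <= s -> s <= t -> `|prim g t - prim g s| <= M * (t - s).
Proof.
move=> s0 st; rewrite /prim Rintegral_itvB ?bnd_simp//; last first.
  by apply: int_bounded; [exact: measurable_itv|exact: itv_fin].
have mi : measurable (`]s, t]%classic : set (measurableTypeR R)) by exact: measurable_itv.
have ii := int_bounded mi (itv_fin _ _ _ _).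
apply: le_trans (le_normr_Rintegral mi ii) _.
have -> : M * (t - s) = \int[mu]_(x in `]s, t]) M.
  rewrite Rintegral_cst//; congr (_ * _).
  have st_len : mu `]s, t]%classic = (t - s)%:E.
    rewrite lebesgue_measure_itv/= lte_fin -EFinB; case: ltP => // ts.
    by congr _%:E; lra.
  exact: (esym (congr1 fine st_len)).
apply: le_Rintegral => //.
- have -> : EFin \o (fun x => `|g x|) = abse \o (EFin \o g) by [].
  exact: integrable_abse.
- apply: measurable_bounded_integrable => //; first exact: itv_fin.
  by exists M; split; [exact: num_real|move=> x Mx y _; rewrite /= ger0_norm// ltW].
Qed.

Lemma prim_lip s t : `|prim g s - prim g t| <= M * `|s - t|.
Proof.
wlog st : s t / s <= t.
  by move=> W; have [/W//|/ltW /W] := leP s t; rewrite distrC (distrC t).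
rewrite distrC (distrC s) (ger0_norm (_ : 0 <= t - s)) ?subr_ge0//.
have [t0|t0] := leP t 0.
  by rewrite !prim_le0 ?(le_trans st)// subrr normr0 mulr_ge0// subr_ge0.
have [s0|s0] := leP 0 s; first exact: prim_lip0.
rewrite (prim_le0 (ltW s0)) -(@prim_le0 0)//.
apply: le_trans (prim_lip0 _ (ltW t0)) _ => //.
by apply: ler_wpM2l => //; lra.
Qed.

(** Lebesgue's differentiation theorem. The origin, where [prim g] may
    have a kink, is discarded as a null set. *)
Lemma prim_der : \forall t \ae mu, 0 <= t -> der (prim g) t (g t).
Proof.
have locg : locally_integrable setT g.
  split => //; first exact: openT.
  move=> K _ cK.
  have mK : measurable (K : set (measurableTypeR R)) by exact: compact_measurable.
  by have /integrableP[] := int_bounded mK (compact_finite_measure cK).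
have := @FTC1 R g (BLeft 0) _ locg.
have ig y : mu.-integrable [set` Interval (BLeft 0) (BRight y)] (EFin \o g).
  by apply: int_bounded; [exact: measurable_itv|exact: itv_fin].
have ne0 : \forall t \ae mu, t != 0.
  exists [set 0]; split; [exact: measurable_set1|exact: lebesgue_measure_set1|].
  by move=> t /= /negP; rewrite negbK => /eqP.
move=> /(_ ig); apply: filterS2 ne0 => t /= tn0 h t0.
have [|dp <-] := h; first by rewrite lte_fin lt_neqAle eq_sym tn0.
by rewrite derive1E; exact/derivableP.
Qed.

End prim.

(** * Linear differential equations with measurable coefficients *)

Lemma uniform_bound (R : realType) (T : Type) n (P : T -> Prop) (f : 'I_n -> T -> R) :
  (forall i, exists B, forall t, P t -> `|f i t| <= B) ->
  exists2 B, 0 <= B & forall i t, P t -> `|f i t| <= B.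
Proof.
move=> /choice[B hB]; exists (\sum_i `|B i|); first exact: sumr_ge0.
move=> i t Pt; apply: (le_trans (hB i t Pt)); apply: (le_trans (ler_norm _)).
by rewrite (bigD1 i)//= lerDl sumr_ge0.
Qed.

(** The sequences [u k - 2 * D / 2 ^ k] and [u k + 2 * D / 2 ^ k] are
    nondecreasing and nonincreasing respectively, so [u] is trapped between
    them and the limit comes with an explicit rate. *)
Lemma geometric_limit (R : realType) (u : nat -> R) (D : R) :
  (forall k, `|u k.+1 - u k| <= D * 2^-1 ^+ k) ->
  exists l, forall k, `|u k - l| <= 2 * D * 2^-1 ^+ k.
Proof.
move=> hu.
have D0 : 0 <= D by have := le_trans (normr_ge0 _) (hu 0%N); rewrite expr0 mulr1.
pose E k := 2 * D * 2^-1 ^+ k.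
have ES k : E k.+1 + D * 2^-1 ^+ k = E k by rewrite /E exprS; field.
have E0 k : 0 <= E k by rewrite /E !mulr_ge0// exprn_ge0.
have mono m k : u m - E m <= u (m + k)%N - E (m + k)%N.
  elim: k => [|k IH]; first by rewrite addn0.
  apply: (le_trans IH); rewrite addnS.
  by have := hu (m + k)%N; have := ES (m + k)%N; rewrite ler_norml => ? /andP[]; lra.
have anti m k : u (m + k)%N + E (m + k)%N <= u m + E m.
  elim: k => [|k IH]; first by rewrite addn0.
  apply: le_trans IH; rewrite addnS.
  by have := hu (m + k)%N; have := ES (m + k)%N; rewrite ler_norml => ? /andP[]; lra.
have sep m k : u m - E m <= u k + E k.
  have := mono m k; have := anti k m; rewrite addnC.
  by have := E0 (m + k)%N; lra.
have hS : has_sup (range (fun m => u m - E m)).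
  by split; [exists (u 0%N - E 0%N); exists 0%N|exists (u 0%N + E 0%N) => _ [m _ <-]].
exists (sup (range (fun m => u m - E m))) => k.
have h1 : u k - E k <= sup (range (fun m => u m - E m)).
  by apply: ub_le_sup; [exact: hS.2|exists k].
have h2 : sup (range (fun m => u m - E m)) <= u k + E k.
  by apply: ge_sup; [exact: hS.1|move=> _ [m _ <-]].
by rewrite ler_norml -/(E k); apply/andP; split; lra.
Qed.

Lemma geometric_cvg0 (R : realType) (E : R) : (E * 2^-1 ^+ k) @[k --> \oo] --> 0.
Proof.
by apply: cvg_geometric; rewrite ger0_norm// invf_lt1// ltr1n.
Qed.

Lemma geometric_cvg (R : realType) (u : nat -> R) (l E : R) :
  (forall k, `|u k - l| <= E * 2^-1 ^+ k) -> u k @[k --> \oo] --> l.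
Proof.
move=> hu; apply/cvgrPdist_le => e e0.
have /cvgrPdist_le/(_ e e0) := @geometric_cvg0 R E.
apply: filterS => k; rewrite sub0r normrN => /(le_trans (ler_norm _)).
by rewrite distrC; exact: le_trans.
Qed.

Lemma geometric_eq0 (R : realType) (a E : R) : (forall k, `|a| <= E * 2^-1 ^+ k) -> a = 0.
Proof.
move=> h; have h1 : (fun=> 0 : R) @ \oo --> a.
  by apply: (@geometric_cvg R _ a E) => k; rewrite sub0r normrN.
exact: (cvg_unique _ h1 (cvg_cst 0)).
Qed.

(** Extends functions defined on [0, T] to the line by constants, so that
    measurability and boundedness can be stated on the whole line. *)
Definition clamp (R : realType) (T t : R) : R :=
  if t < 0 then 0 else if T < t then T else t.

Lemma clamp_itv (R : realType) (T t : R) : 0 <= T -> 0 <= clamp T t <= T.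
Proof. by rewrite /clamp; case: ltP; case: ltP; lra. Qed.

Lemma clamp_id (R : realType) (T t : R) : 0 <= t <= T -> clamp T t = t.
Proof. by rewrite /clamp; case: ltP; case: ltP; lra. Qed.

Lemma clamp_dist (R : realType) (T s t : R) :
  0 <= T -> `|clamp T s - clamp T t| <= `|s - t|.
Proof.
move=> T0; wlog st : s t / s <= t.
  by move=> W; have [/W//|/ltW /W] := leP s t; rewrite distrC (distrC t).
rewrite distrC (distrC s) !ger0_norm; rewrite /clamp;
by case: (ltP s 0); case: (ltP T s); case: (ltP t 0); case: (ltP T t); lra.
Qed.

Definition bounded_borel (R : realType) (f : R -> R) : Prop :=
  measurable_fun setT (f : measurableTypeR R -> R) /\ exists B, forall t, `|f t| <= B.

Lemma bounded_borel_cst (R : realType) (c : R) : bounded_borel (fun _ : R => c).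
Proof. by split; [exact: measurable_cst|exists `|c|]. Qed.

Lemma bounded_borel_indic (R : realType) (S : set R) :
  measurable (S : set (measurableTypeR R)) -> bounded_borel (\1_S : R -> R).
Proof.
move=> mS; split; first exact: measurable_indic.
by exists 1 => s; rewrite indicE; case: (s \in S); rewrite ?normr1 ?normr0.
Qed.

Lemma bounded_borelD (R : realType) (f g : R -> R) :
  bounded_borel f -> bounded_borel g -> bounded_borel (fun t => f t + g t).
Proof.
move=> [mf [F hF]] [mg [G hG]]; split; first exact: measurable_funD.
by exists (F + G) => t; rewrite (le_trans (ler_normD _ _))// lerD.
Qed.

Lemma bounded_borelM (R : realType) (f g : R -> R) :
  bounded_borel f -> bounded_borel g -> bounded_borel (fun t => f t * g t).
Proof.
move=> [mf [F hF]] [mg [G hG]]; split; first exact: measurable_funM.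
by exists (F * G) => t; rewrite normrM ler_pM.
Qed.

Lemma bounded_borel_sum (R : realType) n (f : 'I_n -> R -> R) :
  (forall i, bounded_borel (f i)) -> bounded_borel (fun t => \sum_(i < n) f i t).
Proof.
move=> hf; elim: n f hf => [|n IH] f hf.
  rewrite (_ : (fun _ => _) = fun=> 0); first exact: bounded_borel_cst.
  by apply/funext => t; rewrite big_ord0.
rewrite (_ : (fun _ => _) =
    fun t => \sum_(i < n) f (widen_ord (leqnSn n) i) t + f ord_max t).
  by apply: bounded_borelD => //; exact: IH.
by apply/funext => t; rewrite big_ord_recr.
Qed.

Lemma bounded_borel_clamp (R : realType) (T : R) (f : R -> R) :
  0 <= T -> lip 0 T f -> bounded_borel (fun t => f (clamp T t)).
Proof.
move=> T0 lf; have [F F0 hF] := lip_bounded lf; case: lf => L L0 hL.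
split; last by exists F => t; apply: hF; exact: clamp_itv.
apply: continuous_measurable_fun => t; apply/cvgrPdist_le => e e0.
near=> s.
apply: le_trans (hL _ _ (clamp_itv _ T0) (clamp_itv _ T0)) _.
apply: (@le_trans _ _ ((L + 1) * `|t - s|)).
  by apply: ler_pM => //; [lra|exact: clamp_dist].
rewrite -ler_pdivlMl; last lra.
near: s; apply: cvgr_dist_le; first exact: cvg_id.
by rewrite mulr_gt0// invr_gt0; lra.
Unshelve. all: by end_near. Qed.

Lemma bounded_borel_prim_lip (R : realType) (T : R) (g : R -> R) :
  bounded_borel g -> lip 0 T (prim g).
Proof.
move=> [mg [B hB]]; exists B; first exact: le_trans (hB 0).
by move=> s t _ _; exact: prim_lip.
Qed.

Lemma bounded_borel_prim_der (R : realType) (g : R -> R) : bounded_borel g ->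
  \forall t \ae (@lebesgue_measure R), 0 <= t -> der (prim g) t (g t).
Proof. by move=> [mg [B hB]]; exact: prim_der hB. Qed.

Section ode.
Variables (R : realType) (n : nat) (T M : R) (b : 'I_n -> 'I_n -> R -> R)
  (c : 'I_n -> R).
Hypotheses (T0 : 0 <= T)
  (mb : forall i j, measurable_fun setT (b i j : measurableTypeR R -> R))
  (bM : forall i j t, `|b i j t| <= M).

Let velocity (Y : 'I_n -> R -> R) i s := \sum_(j < n) b i j s * Y j s.

Let op (Y : 'I_n -> R -> R) i t := c i + prim (velocity Y i) (clamp T t).

Let K := 2 * (n%:R * `|M| + 1).

Let K0 : 0 <= K. Proof. by rewrite /K mulr_ge0// addr_ge0// mulr_ge0. Qed.

Let bounded_velocity Y i : (forall j, bounded_borel (Y j)) -> bounded_borel (velocity Y i).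
Proof.
move=> hY; apply: bounded_borel_sum => j; apply: bounded_borelM => //.
by split => //; exists M.
Qed.

Let bounded_op Y i : (forall j, bounded_borel (Y j)) -> bounded_borel (op Y i).
Proof.
move=> hY; apply: bounded_borelD; first exact: bounded_borel_cst.
by apply: bounded_borel_clamp => //; apply: bounded_borel_prim_lip; exact: bounded_velocity.
Qed.

(** Contraction in the weighted norm given by [expR (K * t)]: integration in
    time gains a factor [1 / K] against this weight, and [K] exceeds twice the
    Lipschitz constant of the vector field. *)
Let contract_half Y Z C : 0 <= C ->
  (forall j, bounded_borel (Y j)) -> (forall j, bounded_borel (Z j)) ->
  (forall j t, 0 <= t <= T -> `|Y j t - Z j t| <= C * expR (K * t)) ->
  forall i t, 0 <= t <= T ->
    prim (velocity Y i) t - prim (velocity Z i) t <= C * 2^-1 * expR (K * t).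
Proof.
move=> C0 aY aZ hYZ i t /andP[t0 tT].
have aFY := bounded_velocity i aY; have aFZ := bounded_velocity i aZ.
have := @lip_le R T (fun s => prim (velocity Y i) s + - prim (velocity Z i) s)
   (fun s => C * 2^-1 * expR (K * s)) _ _ _ 0 t (lexx 0) t0 tT.
rewrite !(@prim_le0 _ _ 0)// mulr0 expR0 => h.
suff : prim (velocity Y i) t - prim (velocity Z i) t - (0 - 0) <=
   C / 2 * expR (K * t) - C / 2 * 1 by lra.
apply: h.
- by apply: lipD; [exact: bounded_borel_prim_lip|apply: lipN; exact: bounded_borel_prim_lip].
- by apply: lipZ; apply: lip_expR; apply: lipZ; exact: lip_id.
apply: filterS2 (bounded_borel_prim_der aFY) (bounded_borel_prim_der aFZ) =>
  s h1 h2 /andP[s0 sT].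
exists (velocity Y i s + - velocity Z i s), (C * 2^-1 * (expR (K * s) * (K * 1))); split.
- exact: derD (h1 s0) (derN (h2 s0)).
- by apply: derZ; apply: der_expR; apply: derZ; exact: der_id.
rewrite /velocity -sumrB.
apply: (@le_trans _ _ (\sum_(j < n) `|M| * (C * expR (K * s)))).
  apply: ler_sum => j _; rewrite -mulrBr; apply: (le_trans (ler_norm _)).
  rewrite normrM; apply: ler_pM => //; first exact: le_trans (bM i j s) (ler_norm _).
  by apply: hYZ; rewrite s0.
rewrite sumr_const card_ord -[leLHS]mulr_natl.
have := expR_gt0 (K * s); set e := expR _ => e0.
have -> : C / 2 * (e * (K * 1)) = C * e * (n%:R * `|M| + 1) by rewrite /K; field.
have : 0 <= C * e by rewrite mulr_ge0// ltW.
by lra.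
Qed.

Let contract Y Z C : 0 <= C ->
  (forall j, bounded_borel (Y j)) -> (forall j, bounded_borel (Z j)) ->
  (forall j t, 0 <= t <= T -> `|Y j t - Z j t| <= C * expR (K * t)) ->
  forall i t, 0 <= t <= T -> `|op Y i t - op Z i t| <= C * 2^-1 * expR (K * t).
Proof.
move=> C0 aY aZ hYZ i t tT; rewrite /op clamp_id// opprD addrACA subrr add0r.
rewrite ler_norml; apply/andP; split; last exact: contract_half.
have := @contract_half Z Y C C0 aZ aY _ i t tT.
suff h : forall j t, 0 <= t <= T -> `|Z j t - Y j t| <= C * expR (K * t) by move=> /(_ h); lra.
by move=> j s; rewrite distrC; exact: hYZ.
Qed.

Let picard k := iter k op (fun i _ => c i).

Let bounded_picard k i : bounded_borel (picard k i).
Proof. by elim: k i => [|k IH] i; [exact: bounded_borel_cst|exact: bounded_op]. Qed.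

Let picard_clamp k i t : picard k i t = picard k i (clamp T t).
Proof. by case: k => // k; rewrite /= /op (clamp_id (clamp_itv _ T0)). Qed.

(** Carathéodory existence by Picard iteration: the weighted contraction makes
    the iterates converge geometrically, uniformly in time, and the limit is a
    fixed point. *)
Lemma linear_ode : exists y : 'I_n -> R -> R,
  [/\ forall i, lip 0 T (y i), forall i, y i 0 = c i &
      \forall t \ae (@lebesgue_measure R), 0 <= t <= T ->
        forall i, der (y i) t (\sum_(j < n) b i j t * y j t)].
Proof.
have [C C0 hC] : exists2 C, 0 <= C & forall i t, setT t -> `|picard 1 i t - c i| <= C.
  apply: uniform_bound => i.
  have [_ [B hB]] := bounded_borelD (bounded_picard 1 i) (bounded_borel_cst (- c i)).
  by exists B => t _; exact: hB.
have step k i t : 0 <= t <= T ->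
    `|picard k.+1 i t - picard k i t| <= C * 2^-1 ^+ k * expR (K * t).
  elim: k i t => [|k IH] i t tT.
    rewrite expr0 mulr1 (le_trans (hC i t I))// ler_peMr// -expR0 ler_expR.
    by have /andP[t0 _] := tT; rewrite mulr_ge0.
  rewrite exprSr mulrA; apply: (@contract (picard k.+1) (picard k)) => //.
  by rewrite mulr_ge0// exprn_ge0.
pose D := C * expR (K * T).
have stepD k i t : `|picard k.+1 i t - picard k i t| <= D * 2^-1 ^+ k.
  rewrite (picard_clamp k.+1) (picard_clamp k); have tT := clamp_itv t T0.
  apply: (le_trans (step _ _ _ tT)); rewrite /D mulrAC.
  rewrite ler_wpM2r ?exprn_ge0// ler_wpM2l// ler_expR ler_wpM2l//.
  by have /andP[] := tT.
have /choice[y0 hy0] : forall p : 'I_n * R, exists l,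
    forall k, `|picard k p.1 p.2 - l| <= 2 * D * 2^-1 ^+ k.
  by move=> [i t]; apply: geometric_limit => k; exact: stepD.
pose y i t := y0 (i, t).
have hy i t k : `|picard k i t - y i t| <= 2 * D * 2^-1 ^+ k by exact: (hy0 (i, t)).
have D0 : 0 <= D by rewrite mulr_ge0// expR_ge0.
have ay i : bounded_borel (y i).
  split.
    apply: (@measurable_fun_cvg _ _ _ _ (fun k => picard k i)).
      by move=> k; have [] := bounded_picard k i.
    by move=> t _; apply: (@geometric_cvg _ _ _ (2 * D)) => k; exact: hy.
  exists (`|c i| + 2 * D) => t; have := hy i t 0%N; rewrite expr0 mulr1 /= => h.
  have := ler_normB (c i) (c i - y i t); rewrite opprB addrC subrK.
  by move=> /le_trans; apply; rewrite lerD2l.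
(* The pointwise limit [y] is a solution, but its regularity is only visible on
   the primitive [z], which agrees with it on [0, T]. *)
pose z i t := c i + prim (velocity y i) t.
have zy i t : 0 <= t <= T -> z i t = y i t.
  move=> tT; apply/eqP; rewrite -subr_eq0; apply/eqP.
  apply: (@geometric_eq0 _ _ (D * expR (K * T) + D)) => k.
  have h1 : `|op y i t - op (picard k) i t| <= 2 * D * 2^-1 ^+ k * 2^-1 * expR (K * t).
    apply: contract => //; first by rewrite !mulr_ge0// exprn_ge0.
    move=> j s /andP[s0 _]; rewrite distrC (le_trans (hy j s k))// ler_peMr//.
      by rewrite !mulr_ge0// exprn_ge0.
    by rewrite -expR0 ler_expR mulr_ge0.
  have h2 := hy i t k.+1.
  have zE : z i t = op y i t by rewrite /op clamp_id.
  have -> : z i t - y i t = (op y i t - op (picard k) i t) + (picard k.+1 i t - y i t).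
    by rewrite zE /picard /= addrA subrK.
  apply: (le_trans (ler_normD _ _)); rewrite mulrDl; apply: lerD.
    apply: (le_trans h1).
    have -> : 2 * D * 2^-1 ^+ k * 2^-1 * expR (K * t) = D * 2^-1 ^+ k * expR (K * t).
      by field.
    rewrite (mulrAC D) ler_wpM2r ?exprn_ge0// ler_wpM2l// ler_expR ler_wpM2l//.
    by have /andP[] := tT.
  by rewrite (le_trans h2)// exprS; have := exprn_ge0 k (ltW (_ : 0 < 2^-1 :> R)); lra.
exists z; split.
- move=> i; apply: lipD; first exact: lip_cst.
  by apply: bounded_borel_prim_lip; exact: bounded_velocity.
- by move=> i; rewrite /z prim_le0// addr0.
have : \forall t \ae (@lebesgue_measure R), forall i, 0 <= t ->
    der (prim (velocity y i)) t (velocity y i t).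
  by apply: filter_forall => i; apply: bounded_borel_prim_der; exact: bounded_velocity.
apply: filterS => t h /andP[t0 tT] i.
have -> : \sum_(j < n) b i j t * z j t = 0 + velocity y i t.
  by rewrite add0r; apply: eq_bigr => j _; rewrite zy// t0.
by apply: derD; exact: h.
Qed.

End ode.

Lemma lip_constant (R : realType) (T : R) (f : R -> R) : 0 <= T -> lip 0 T f ->
  (\forall t \ae (@lebesgue_measure R), 0 <= t <= T -> der f t 0) -> f T = f 0.
Proof.
move=> T0 lf hf; apply/eqP; rewrite eq_le.
have l0 := lip_cst 0 T (0 : R).
have h1 := @lip_le R T f (fun=> 0) lf l0 _ 0 T (lexx 0) T0 (lexx T).
have h2 := @lip_le R T (fun=> 0) f l0 lf _ 0 T (lexx 0) T0 (lexx T).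
apply/andP; split.
- suff : f T - f 0 <= 0 - 0 by lra.
  apply: h1; apply: filterS hf => t /[apply] ht.
  by exists 0, 0; split => //; exact: der_cst.
- suff : 0 - 0 <= f T - f 0 by lra.
  apply: h2; apply: filterS hf => t /[apply] ht.
  by exists 0, 0; split => //; exact: der_cst.
Qed.

(** [linear_ode] prescribes initial values. The terminal condition is met by
    duality: if [X] and [Y] are the fundamental matrices of the system and of
    its adjoint, then the pairings of their columns are constant in time, so
    the values of [X] at [T] invert those of [Y]. *)
Lemma adjoint_ode (R : realType) (n : nat) (T M : R) (b : 'I_n -> 'I_n -> R -> R)
    (pT : 'I_n -> R) :
  0 <= T ->
  (forall i j, measurable_fun setT (b i j : measurableTypeR R -> R)) ->
  (forall i j t, `|b i j t| <= M) ->
  exists p : 'I_n -> R -> R,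
  [/\ forall i, lip 0 T (p i), forall i, p i T = pT i &
      \forall t \ae (@lebesgue_measure R), 0 <= t <= T ->
        forall i, der (p i) t (- \sum_(j < n) b j i t * p j t)].
Proof.
move=> T0 mb bM.
pose e k i : R := (k == i :> 'I_n)%:R.
have /choice[X hX] : forall k, exists y : 'I_n -> R -> R,
  [/\ forall i, lip 0 T (y i), forall i, y i 0 = e k i &
      \forall t \ae (@lebesgue_measure R), 0 <= t <= T ->
        forall i, der (y i) t (\sum_(j < n) b i j t * y j t)].
  by move=> k; exact: linear_ode T0 mb bM.
have /choice[Y hY] : forall k, exists y : 'I_n -> R -> R,
  [/\ forall i, lip 0 T (y i), forall i, y i 0 = e k i &
      \forall t \ae (@lebesgue_measure R), 0 <= t <= T ->
        forall i, der (y i) t (\sum_(j < n) - b j i t * y j t)].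
  move=> k; apply: (@linear_ode _ _ _ M (fun i j t => - b j i t)) => // i j.
    exact: measurableT_comp.
  by move=> t; rewrite normrN.
have XY k l : \sum_i X k i T * Y l i T = (k == l)%:R.
  have [lX X0 dX] := hX k; have [lY Y0 dY] := hY l.
  transitivity (\sum_i X k i 0 * Y l i 0).
    apply: (@lip_constant R T (fun t => \sum_i X k i t * Y l i t)) => //.
      by apply: lip_sum => i; exact: lipM.
    apply: filterS2 dX dY => t hXt hYt tT.
    have := der_sum (fun i => derM (hXt tT i) (hYt tT i)).
    congr (is_derive _ _ _ _).
    rewrite big_split/=.
    under eq_bigr do rewrite mulr_sumr.
    under [X in _ + X]eq_bigr do rewrite mulr_sumr.
    rewrite exchange_big/= -big_split/= big1// => i _.
    by rewrite -big_split/= big1// => j _; ring.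
  under eq_bigr do rewrite X0 Y0 /e.
  rewrite (bigD1 k)//= eqxx mul1r big1 ?addr0; first by rewrite eq_sym.
  by move=> i ik; rewrite eq_sym (negbTE ik) mul0r.
pose XT := \matrix_(k < n, i < n) X k i T.
pose YT := \matrix_(i < n, l < n) Y l i T.
have /mulmx1C YX : XT *m YT = 1%:M.
  apply/matrixP => k l; rewrite !mxE -XY.
  by apply: eq_bigr => i _; rewrite !mxE.
pose w := XT *m (\col_m pT m).
exists (fun i t => \sum_l w l 0 * Y l i t); split.
- by move=> i; apply: lip_sum => l; apply: lipZ; have [] := hY l.
- move=> i; have := congr1 (fun A => (A *m (\col_m pT m)) i 0) YX.
  rewrite /= mul1mx -mulmxA [RHS]mxE => <-.
  by rewrite mxE; apply: eq_bigr => l _; rewrite !mxE mulrC.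
have : \forall t \ae (@lebesgue_measure R), forall l, 0 <= t <= T ->
    forall i, der (Y l i) t (\sum_(j < n) - b j i t * Y l j t).
  by apply: filter_forall => l; have [] := hY l.
apply: filterS => t hd tT i.
have := der_sum (fun l => derZ (w l 0) (hd l tT i)).
congr (is_derive _ _ _ _).
under eq_bigr do rewrite mulr_sumr.
rewrite exchange_big/= -sumrN; apply: eq_bigr => j _.
by rewrite mulr_sumr -sumrN; apply: eq_bigr => l _; ring.
Qed.

(** * The needle variation *)

Lemma sumr_cst_ord (R : realType) (n : nat) (a : R) : \sum_(i < n) a = n%:R * a.
Proof. by rewrite sumr_const card_ord -[LHS]mulr_natl. Qed.

(** The difference is [(M + a) / 2 * (x - y)^2 + (M - a) / 2 * (x + y)^2]. *)
Lemma young_le (R : realType) (M a x y : R) :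
  `|a| <= M -> 2 * x * (a * y) <= M * (x ^+ 2 + y ^+ 2).
Proof.
rewrite ler_norml => /andP[a1 a2].
have h1 : 0 <= (M + a) * (x - y) ^+ 2 by rewrite mulr_ge0 ?sqr_ge0//; lra.
have h2 : 0 <= (M - a) * (x + y) ^+ 2 by rewrite mulr_ge0 ?sqr_ge0//; lra.
have E : (M + a) * (x - y) ^+ 2 + (M - a) * (x + y) ^+ 2 =
  2 * (M * (x ^+ 2 + y ^+ 2)) - 2 * (2 * x * (a * y)) by ring.
lra.
Qed.

(** A Gronwall estimate for [E = \sum_k z_k ^ 2]. The forcing term acts only
    where [chi] is positive, and [2 * z * d <= z ^ 2 / delta + delta * d ^ 2]
    gives

      [E' <= 2 * n * M * E + chi * (E / delta + n * delta * D ^ 2)].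

    Since [chi] has integral at most [delta], the term [chi * E / delta] costs
    only a factor [expR 1] in the integrating factor, and [E] is of order
    [delta ^ 2]. *)
Lemma forced_growth (R : realType) (n : nat) (T M D delta : R)
    (b : 'I_n -> 'I_n -> R -> R) (d : 'I_n -> R -> R) (z : 'I_n -> R -> R)
    (chi G : R -> R) :
  0 <= M -> 0 < delta ->
  lip 0 T G -> G 0 = 0 -> (forall t, 0 <= t <= T -> 0 <= G t <= delta) ->
  (forall i, lip 0 T (z i)) -> (forall i, z i 0 = 0) ->
  (\forall t \ae (@lebesgue_measure R), 0 <= t <= T ->
    [/\ 0 <= chi t, der G t (chi t),
        forall i j, `|b i j t| <= M, forall i, `|d i t| <= D &
        forall i, der (z i) t (\sum_j b i j t * z j t + chi t * d i t)]) ->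
  forall i t, 0 <= t <= T ->
    `|z i t| <= Num.sqrt (n%:R * D ^+ 2 * expR (2 * n%:R * M * T + 1)) * delta.
Proof.
move=> M0 d0 lG G0 hG lz z0 hd i t tT; have d0' := ltW d0.
have D2 : 0 <= D ^+ 2 by exact: sqr_ge0.
pose E s := \sum_k z k s ^+ 2.
(* Minus the logarithm of the integrating factor. *)
pose H s := 2 * n%:R * M * s + delta^-1 * G s.
have nM0 : 0 <= 2 * n%:R * M by rewrite !mulr_ge0.
have H0 s : 0 <= s <= T -> 0 <= H s.
  move=> sT; have /andP[s0 _] := sT; have /andP[g0 _] := hG s sT.
  by rewrite addr_ge0// mulr_ge0// invr_ge0 ltW.
have lE : lip 0 T E by apply: lip_sum => k; exact: lipM.
have lH : lip 0 T H by apply: lipD; apply: lipZ => //; exact: lip_id.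
have /andP[t0 tT'] := tT.
have := @lip_le R T (fun s => E s * expR (- H s))
   (fun s => n%:R * D ^+ 2 * delta * G s) _ _ _ 0 t (lexx 0) t0 tT'.
have -> : E 0 = 0 by rewrite /E big1// => k _; rewrite z0 expr0n.
rewrite mul0r G0 mulr0 !subr0 => hF.
have {hF} : E t * expR (- H t) <= n%:R * D ^+ 2 * delta * G t.
  apply: hF.
  - by apply: lipM => //; apply: lip_expR; exact: lipN.
  - exact: lipZ.
  apply: filterS hd => s hs sT; have [c0 dG bM dD dz] := hs sT.
  pose dE := \sum_k (z k s * (\sum_j b k j s * z j s + chi s * d k s) +
                     z k s * (\sum_j b k j s * z j s + chi s * d k s)).
  have hE : der E s dE by apply: der_sum => k; exact: derM.
  have hH : der H s (2 * n%:R * M * 1 + delta^-1 * chi s).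
    by apply: derD; apply: derZ => //; exact: der_id.
  exists (E s * (expR (- H s) * - (2 * n%:R * M * 1 + delta^-1 * chi s)) + expR (- H s) * dE),
    (n%:R * D ^+ 2 * delta * chi s); split.
  - by apply: derM => //; apply: der_expR; exact: derN.
  - exact: derZ.
  have key : dE <= 2 * n%:R * M * E s + chi s * (delta^-1 * E s + n%:R * (delta * D ^+ 2)).
    have -> : 2 * n%:R * M * E s + chi s * (delta^-1 * E s + n%:R * (delta * D ^+ 2)) =
      \sum_k (\sum_j (M * (z k s ^+ 2 + z j s ^+ 2)) +
              chi s * (delta^-1 * z k s ^+ 2 + delta * D ^+ 2)).
      rewrite big_split/= -[X in _ = _ + X]mulr_sumr big_split/= -mulr_sumr sumr_cst_ord.
      under eq_bigr do rewrite -mulr_sumr big_split/= sumr_cst_ord -/(E s).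
      by rewrite -mulr_sumr big_split/= sumr_cst_ord -mulr_sumr -/(E s); ring.
    apply: ler_sum => k _.
    rewrite -mulrDl -mulr2n -mulr_natl mulrCA.
    have -> : (2 * z k s) * (\sum_j b k j s * z j s + chi s * d k s) =
       \sum_j (2 * z k s * (b k j s * z j s)) + chi s * (2 * z k s * d k s).
      by rewrite mulrDr mulr_sumr; congr (_ + _); ring.
    apply: lerD.
      by apply: ler_sum => j _; exact: young_le.
    apply: ler_wpM2l => //.
    have : d k s ^+ 2 <= D ^+ 2.
      by have := dD k; rewrite ler_norml => /andP[]; nra.
    have : 0 <= delta^-1 * (z k s - delta * d k s) ^+ 2.
      by rewrite mulr_ge0 ?sqr_ge0// invr_ge0 ltW.
    have -> : delta^-1 * (z k s - delta * d k s) ^+ 2 =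
      delta^-1 * z k s ^+ 2 - 2 * z k s * d k s + delta * d k s ^+ 2.
      by field; lra.
    by nra.
  have e1 : expR (- H s) <= 1 by rewrite -expR0 ler_expR oppr_le0; exact: H0.
  have e0 := expR_ge0 (- H s).
  set e := expR (- H s) in e0 e1 *.
  have -> : E s * (e * - (2 * n%:R * M * 1 + delta^-1 * chi s)) + e * dE =
    e * (dE - (2 * n%:R * M * E s + chi s * (delta^-1 * E s))) by ring.
  apply: (@le_trans _ _ (e * (chi s * (n%:R * (delta * D ^+ 2))))).
    by apply: ler_wpM2l => //; lra.
  have : 0 <= chi s * (n%:R * (delta * D ^+ 2)).
    by do ?[apply: mulr_ge0 => //].
  by nra.
have /andP[g0 g1] := hG t tT.
move=> hF.
have Et : E t <= n%:R * D ^+ 2 * expR (2 * n%:R * M * T + 1) * delta ^+ 2.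
  have -> : E t = E t * expR (- H t) * expR (H t).
    by rewrite -mulrA -expRD addNr expR0 mulr1.
  have hHt : H t <= 2 * n%:R * M * T + 1.
    by apply: lerD; [exact: ler_wpM2l|rewrite ler_pdivrMl ?mulr1].
  have -> : n%:R * D ^+ 2 * expR (2 * n%:R * M * T + 1) * delta ^+ 2 =
    n%:R * D ^+ 2 * delta * delta * expR (2 * n%:R * M * T + 1) by ring.
  have nD : 0 <= n%:R * D ^+ 2 * delta by do ?[apply: mulr_ge0 => //].
  apply: (@le_trans _ _ (n%:R * D ^+ 2 * delta * delta * expR (H t))).
    rewrite ler_wpM2r ?expR_ge0//; apply: (le_trans hF); exact: ler_wpM2l.
  by rewrite ler_wpM2l ?ler_expR// mulr_ge0// ltW.
have zE : z i t ^+ 2 <= E t.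
  by rewrite /E (bigD1 i)//= lerDl sumr_ge0// => k _; exact: sqr_ge0.
have cN0 : 0 <= n%:R * D ^+ 2 * expR (2 * n%:R * M * T + 1).
  by do ?[apply: mulr_ge0 => //]; exact: expR_ge0.
rewrite -(@ler_pXn2r _ 2)// ?nnegrE ?mulr_ge0 ?sqrtr_ge0//.
by rewrite exprMn sqr_sqrtr// real_normK ?num_real//; exact: le_trans zE Et.
Qed.

Lemma sum2_le (R : realType) (n : nat) (F : 'I_n -> 'I_n -> R) (B : R) :
  (forall i j, F i j <= B) -> \sum_i \sum_j F i j <= n%:R * (n%:R * B).
Proof.
move=> h; apply: (@le_trans _ _ (\sum_(i < n) \sum_(j < n) B)).
  by apply: ler_sum => i _; apply: ler_sum => j _; exact: h.
by rewrite !sumr_cst_ord.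
Qed.

Lemma entry_le (R : realType) (n : nat) (B : 'I_n -> 'I_n -> R) i j :
  `|B i j| <= \sum_i \sum_j `|B i j|.
Proof.
rewrite (bigD1 i)//= (bigD1 j)//= -addrA lerDl addr_ge0// sumr_ge0// => k _.
exact: sumr_ge0.
Qed.

Section needle.
Variables (R : realType) (n : nat) (T M W : R) (Q : 'I_n -> 'I_n -> R)
  (b : 'I_n -> 'I_n -> R -> R) (x p : 'I_n -> R -> R).
Hypotheses (T0 : 0 <= T) (M0 : 0 <= M) (W0 : 0 <= W).
Hypotheses (lx : forall i, lip 0 T (x i)) (lp : forall i, lip 0 T (p i)).
Hypothesis bM : forall i j t, `|b i j t| <= M.
Hypothesis dx : \forall t \ae (@lebesgue_measure R), 0 <= t <= T ->
  forall i, der (x i) t (\sum_j b i j t * x j t).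
Hypothesis dp : \forall t \ae (@lebesgue_measure R), 0 <= t <= T ->
  forall i, der (p i) t (- \sum_j b j i t * p j t).
Hypothesis pT : forall i, p i T = \sum_j (Q i j + Q j i) * x j T.

(** With [z = y - x] and [q] the quadratic form of [Q], the terminal cost
    satisfies [q (y T) = q (x T) + p T * z T + q (z T)] by the choice of [p T]. By [forced_growth],
    [z] is of order [delta], which settles the last term. The derivative of
    [p * z] is [chi * (p w z + p w x)], because the terms with [b] cancel
    by the adjoint equation; the second summand is nonpositive and the first is
    of order [chi * delta], whose integral is of order [delta ^ 2]. *)
Lemma needle_variation : exists C, forall (delta : R) (chi G : R -> R)
    (w : 'I_n -> 'I_n -> R -> R) (y : 'I_n -> R -> R),
  0 < delta -> lip 0 T G -> G 0 = 0 ->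
  (forall t, 0 <= t <= T -> 0 <= G t <= delta) ->
  (forall t, 0 <= chi t <= 1) ->
  (forall i j t, `|w i j t| <= W) ->
  (forall i, lip 0 T (y i)) -> (forall i, y i 0 = x i 0) ->
  (forall t, 0 <= t <= T -> chi t * (\sum_i \sum_j p i t * w i j t * x j t) <= 0) ->
  (\forall t \ae (@lebesgue_measure R), 0 <= t -> der G t (chi t)) ->
  (\forall t \ae (@lebesgue_measure R), 0 <= t <= T ->
    forall i, der (y i) t (\sum_j (b i j t + chi t * w i j t) * y j t)) ->
  \sum_i \sum_j y i T * Q i j * y j T <=
    \sum_i \sum_j x i T * Q i j * x j T + C * delta ^+ 2.
Proof.
have [X X0 hX] := uniform_bound (P := fun t => 0 <= t <= T) (f := x)
  (fun i => let: ex_intro2 B _ h := lip_bounded (lx i) in ex_intro _ B h).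
have [P P0 hP] := uniform_bound (P := fun t => 0 <= t <= T) (f := p)
  (fun i => let: ex_intro2 B _ h := lip_bounded (lp i) in ex_intro _ B h).
have [q q0 hq] : exists2 q, 0 <= q & forall i j, `|Q i j| <= q.
  exists (\sum_i \sum_j `|Q i j|); last exact: entry_le.
  by apply: sumr_ge0 => i _; exact: sumr_ge0.
pose D := n%:R * (W * X).
pose c := Num.sqrt (n%:R * D ^+ 2 * expR (2 * n%:R * (M + W) * T + 1)).
have c0 : 0 <= c by exact: sqrtr_ge0.
exists (n%:R * (n%:R * (P * W * c)) + n%:R * (n%:R * (c * q * c))).
move=> delta chi G w y d0 lG G0 hG chi01 wW ly y0 hdec dG dy.
pose z i t := y i t + - x i t.
pose d i t := \sum_j w i j t * x j t.
have lz i : lip 0 T (z i) by apply: lipD => //; exact: lipN.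
have z0 i : z i 0 = 0 by rewrite /z y0 subrr.
have dz : \forall t \ae (@lebesgue_measure R), 0 <= t <= T ->
    forall i, der (z i) t (\sum_j (b i j t + chi t * w i j t) * z j t + chi t * d i t).
  apply: filterS2 dx dy => t hx hy tT i.
  have := derD (hy tT i) (derN (hx tT i)).
  congr (is_derive _ _ _ _); rewrite /d mulr_sumr -big_split/= -sumrB.
  by apply: eq_bigr => j _; rewrite /z; ring.
have hz i t : 0 <= t <= T -> `|z i t| <= c * delta.
  apply: (@forced_growth R n T (M + W) D delta
    (fun i j t => b i j t + chi t * w i j t) d z chi G) => //.
    exact: addr_ge0.
  apply: filterS2 dG dz => s hs1 hs2 sT; have /andP[s0 _] := sT.
  have /andP[c1 c2] := chi01 s.
  split => //; [exact: hs1| | |exact: hs2].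
  - move=> k j; rewrite (le_trans (ler_normD _ _))// lerD//.
    rewrite normrM ger0_norm// -[leRHS]mul1r ler_pM//.
  - move=> k; rewrite /d (le_trans (ler_norm_sum _ _ _))//.
    apply: (@le_trans _ _ (\sum_(j < n) W * X)); last by rewrite sumr_cst_ord.
    by apply: ler_sum => j _; rewrite normrM ler_pM// hX.
have pz : \sum_i p i T * z i T <= n%:R * (n%:R * (P * W * c)) * delta ^+ 2.
  have := @lip_le R T (fun s => \sum_i p i s * z i s)
     (fun s => n%:R * (n%:R * (P * W * c)) * delta * G s) _ _ _ 0 T (lexx 0) T0 (lexx T).
  rewrite [X in _ - X]big1 ?subr0; last by move=> i _; rewrite z0 mulr0.
  rewrite G0 mulr0 subr0 => h.
  apply: (@le_trans _ _ (n%:R * (n%:R * (P * W * c)) * delta * G T)); last first.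
    have -> : n%:R * (n%:R * (P * W * c)) * delta ^+ 2 =
        n%:R * (n%:R * (P * W * c)) * delta * delta by ring.
    apply: ler_wpM2l.
      by do ?[apply: mulr_ge0 => //]; exact: ltW.
    by have /andP[] := hG T ltac:(by rewrite T0 lexx).
  apply: h.
  - by apply: lip_sum => i; exact: lipM.
  - exact: lipZ.
  apply: filterS3 dG dz dp => s hs1 hs2 hs3 sT; have /andP[s0 _] := sT.
  have /andP[c1 c2] := chi01 s.
  exists (\sum_i (p i s * (\sum_j (b i j s + chi s * w i j s) * z j s + chi s * d i s)
      + z i s * (- \sum_j b j i s * p j s))),
     (n%:R * (n%:R * (P * W * c)) * delta * chi s); split.
  - by apply: der_sum => i; apply: derM; [exact: hs3|exact: hs2].
  - by apply: derZ; exact: hs1.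
  have -> : \sum_i (p i s * (\sum_j (b i j s + chi s * w i j s) * z j s + chi s * d i s)
      + z i s * (- \sum_j b j i s * p j s)) =
    chi s * (\sum_i \sum_j p i s * w i j s * z j s) +
    chi s * (\sum_i \sum_j p i s * w i j s * x j s).
    rewrite big_split/=.
    have -> : \sum_i z i s * (- \sum_j b j i s * p j s) =
       - \sum_i \sum_j p i s * b i j s * z j s.
      rewrite exchange_big/= -sumrN; apply: eq_bigr => i _.
      by rewrite mulrN mulr_sumr; congr (- _); apply: eq_bigr => j _; ring.
    rewrite !mulr_sumr -sumrN -!big_split/=; apply: eq_bigr => i _.
    rewrite /d mulrDr !mulr_sumr -sumrN -!big_split/=; apply: eq_bigr => j _.
    by ring.
  have h1 := hdec s sT.
  have h2 : \sum_i \sum_j p i s * w i j s * z j s <= n%:R * (n%:R * (P * W * (c * delta))).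
    apply: sum2_le => i j; apply: (le_trans (ler_norm _)).
    rewrite !normrM ler_pM ?mulr_ge0//; last exact: hz.
    by rewrite ler_pM// hP.
  apply: (@le_trans _ _ (chi s * (n%:R * (n%:R * (P * W * (c * delta)))) + 0)).
    exact: lerD (ler_wpM2l c1 h2) h1.
  by rewrite addr0 le_eqVlt; apply/orP; left; apply/eqP; ring.
have TT : 0 <= T <= T by rewrite T0 lexx.
have zz : \sum_i \sum_j z i T * Q i j * z j T <= n%:R * (n%:R * (c * q * c)) * delta ^+ 2.
  apply: (@le_trans _ _ (n%:R * (n%:R * ((c * delta) * q * (c * delta))))).
    apply: sum2_le => i j; apply: (le_trans (ler_norm _)).
    rewrite !normrM ler_pM ?mulr_ge0//; last exact: hz.
    by rewrite ler_pM// hz.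
  by rewrite le_eqVlt; apply/orP; left; apply/eqP; ring.
have -> : \sum_i \sum_j y i T * Q i j * y j T =
    \sum_i \sum_j x i T * Q i j * x j T + \sum_i p i T * z i T +
    \sum_i \sum_j z i T * Q i j * z j T.
  have -> : \sum_i p i T * z i T =
      \sum_i \sum_j z i T * Q i j * x j T + \sum_i \sum_j x i T * Q i j * z j T.
    rewrite [X in _ + X]exchange_big/= -big_split/=; apply: eq_bigr => i _.
    rewrite pT mulr_suml -big_split/=; apply: eq_bigr => j _; ring.
  rewrite -!big_split/=; apply: eq_bigr => i _.
  by rewrite -!big_split/=; apply: eq_bigr => j _; rewrite /z; ring.
by rewrite mulrDl; lra.
Qed.

End needle.

(** * Vector trajectories and their entries *)

Lemma borel_fun_completed (R : realType) (D : set R) (f : R -> R) :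
  measurable (D : set (measurableTypeR R)) ->
  measurable_fun setT (f : measurableTypeR R -> R) ->
  measurable_fun (D : set (lebesgueTypeR R)) (f : lebesgueTypeR R -> R).
Proof.
move=> mD mf _ B mB; apply: borel_completed_measurable; apply: measurableI => //.
by rewrite -[X in measurable X]setTI; exact: mf.
Qed.

Lemma is_derive_entry (R : realType) (n : nat) (x : R -> 'cV[R]_n) (t : R) (v : 'cV[R]_n) i :
  is_derive (t : R) 1 x v -> der (fun s => x s i 0) t (v i 0).
Proof.
move=> [dx <-]; have /derivable_mxP/(_ i 0) dxi := dx.
by rewrite derive_mx// mxE; exact/derivableP.
Qed.

Lemma is_derive_col (R : realType) (n : nat) (y : 'I_n -> R -> R) (t : R) (v : 'cV[R]_n) :
  (forall i, der (y i) t (v i 0)) ->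
  is_derive (t : R) 1 (fun s => \col_i y i s : 'cV[R]_n) v.
Proof.
move=> hy.
have yE i j : (fun s => (\col_k y k s : 'cV[R]_n) i j) = y i.
  by apply/funext => s; rewrite mxE.
have dY : derivable (fun s => \col_i y i s : 'cV[R]_n) t 1.
  by apply/derivable_mxP => i j; rewrite yE; have [] := hy i.
split => //; rewrite derive_mx//; apply/matrixP => i j; rewrite mxE yE (ord1 j).
by have [] := hy i.
Qed.

Lemma ac_entry (R : realType) (n : nat) (a b : R) (x : R -> 'cV[R]_n) i :
  abs_continuous a b x -> abs_continuous a b (fun t => x t i 0).
Proof.
move=> h e e0; have [d d0 hd] := h e e0; exists d => // k l r h1 h2 h3.
apply: le_lt_trans (hd k l r h1 h2 h3); apply: ler_sum => j _.
rewrite [leRHS]/Num.Def.normr/= mx_normrE.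
by apply: le_trans (le_bigmax _ _ (i, 0)); rewrite !mxE.
Qed.

Lemma lip_col (R : realType) (n : nat) (a b : R) (y : 'I_n -> R -> R) :
  (forall i, lip a b (y i)) -> abs_continuous a b (fun s => \col_i y i s : 'cV[R]_n).
Proof.
move=> hy.
have /choice[L hL] : forall i, exists L, 0 <= L /\
    forall s t, a <= s <= b -> a <= t <= b -> `|y i s - y i t| <= L * `|s - t|.
  by move=> i; have [L L0 h] := hy i; exists L.
have SL0 : 0 <= \sum_i L i by apply: sumr_ge0 => i _; have [] := hL i.
apply: (lip_ac SL0) => s t hs ht.
rewrite [leLHS]/Num.Def.normr/= mx_normrE bigmax_le ?mulr_ge0// => -[i j] _.
rewrite !mxE/=; have [L0 h] := hL i; apply: (le_trans (h _ _ hs ht)).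
rewrite ler_wpM2r// (bigD1 i)//= lerDl sumr_ge0// => k _.
by have [] := hL k.
Qed.

Lemma ac_small (R : realType) (a b : R) (f : R -> R) (e : R) :
  abs_continuous a b f -> 0 < e ->
  exists2 d, 0 < d &
    forall s t, a <= s <= b -> a <= t <= b -> `|s - t| < d -> `|f s - f t| < e.
Proof.
move=> h e0; have [d d0 hd] := h e e0; exists d => // s t.
wlog st : s t / s <= t.
  move=> W hs ht; have [/W|/ltW /W] := leP s t; first exact.
  by rewrite distrC (distrC (f t)); apply.
move=> /andP[s1 s2] /andP[t1 t2]; rewrite distrC ger0_norm ?subr_ge0// => td.
have := hd 1%N (fun=> s) (fun=> t); rewrite !big_ord1 distrC; apply => //.
by move=> i j _ _ _; rewrite (ord1 i) (ord1 j).
Qed.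

Lemma ac_bounded (R : realType) (T : R) (f : R -> R) : 0 <= T ->
  abs_continuous 0 T f -> exists B, forall t, 0 <= t <= T -> `|f t| <= B.
Proof.
move=> T0 acf.
have cf : continuous (fun t => `|f (clamp T t)|).
  move=> t; apply/cvgrPdist_lt => e e0.
  have [d d0 hd] := ac_small acf e0.
  near=> s; apply: le_lt_trans (ler_dist_dist _ _) _.
  apply: hd; try exact: clamp_itv.
  apply: le_lt_trans (clamp_dist _ _ T0) _.
  by near: s; apply: cvgr_dist_lt => //; exact: cvg_id.
have [c _ hc] := EVT_max T0 (continuous_subspaceT cf).
exists `|f (clamp T c)| => t tT; rewrite -{1}(clamp_id tT).
by apply: hc; rewrite in_itv.
Unshelve. all: by end_near. Qed.

Lemma ac_sub_linear (R : realType) (a b c d L : R) (f : R -> R) :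
  a <= c -> d <= b -> 0 <= L ->
  abs_continuous a b f -> abs_continuous c d (fun t => f t + - (L * t)).
Proof.
move=> ac db L0 h e e0; have [r r0 hr] := h _ (divr_gt0 e0 (ltr0Sn _ 1)).
have [q q0 hq] := lip_ac (V := R) (a := a) (b := b) L0 (f := fun t => L * t)
  (fun s t _ _ => ltac:(by rewrite -mulrBr normrM ger0_norm)) (divr_gt0 e0 (ltr0Sn _ 1)).
exists (Num.min r q); first by rewrite lt_min r0.
move=> k l u h1 h2; rewrite lt_min => /andP[h3 h4].
have h1' j : [/\ a <= l j, l j <= u j & u j <= b].
  by have [? ? ?] := h1 j; split => //; [exact: le_trans ac _|exact: le_trans db].
apply: le_lt_trans (_ : \sum_(j < k) (`|f (u j) - f (l j)| + `|L * u j - L * l j|) < e).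
  apply: ler_sum => j _.
  have -> : f (u j) + - (L * u j) - (f (l j) + - (L * l j)) =
    (f (u j) - f (l j)) - (L * u j - L * l j) by ring.
  exact: ler_normB.
rewrite big_split/= (splitr e); apply: ltrD; first exact: hr.
exact: hq.
Qed.

(** Bounding the derivative of a trajectory requires a bound on the trajectory
    itself, which [ac_bounded] provides; afterwards the calculus of Lipschitz
    functions applies. *)
Lemma ac_der_lip (R : realType) (T L : R) (f : R -> R) : 0 <= L ->
  abs_continuous 0 T f ->
  (\forall t \ae (@lebesgue_measure R), 0 <= t <= T ->
     exists2 df, der f t df & `|df| <= L) ->
  lip 0 T f.
Proof.
move=> L0 acf hd; exists L => // s t.
wlog st : s t / s <= t.
  move=> W hs ht; have [/W|/ltW /W] := leP s t; first exact.
  by rewrite distrC (distrC s); apply.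
move=> /andP[s0 sT] /andP[t0 tT].
rewrite distrC (distrC s) (ger0_norm (_ : 0 <= t - s)) ?subr_ge0//.
have up (g : R -> R) : abs_continuous 0 T g ->
    (\forall t \ae (@lebesgue_measure R), 0 <= t <= T ->
     exists2 df, der g t df & `|df| <= L) -> g t - g s <= L * (t - s).
  move=> acg hg.
  have := @ac_nonincreasing R (fun t => g t + - (L * t)) s t st (ac_sub_linear s0 tT L0 acg).
  move=> h; suff : g t + - (L * t) <= g s + - (L * s) by lra.
  apply: h; apply: filterS hg => r hr /andP[r1 r2].
  have [|dg h1 h2] := hr; first by rewrite (le_trans s0 r1) (le_trans r2 tT).
  exists (dg + - (L * 1)); first by apply: derD => //; apply: derN; apply: derZ; exact: der_id.
  by have := ler_norm dg; lra.
rewrite ler_norml; apply/andP; split; last exact: up.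
have := up (fun t => - f t) _ _; have -> : - f t - - f s = - (f t - f s) by ring.
move=> h; rewrite lerNl; apply: h.
  move=> e e0; have [d d0 h] := acf e e0; exists d => // k l r h1 h2 h3.
  by under eq_bigr do rewrite -opprD normrN; exact: h.
apply: filterS hd => r /[apply] -[df h1 h2].
by exists (- df); [exact: derN|rewrite normrN].
Qed.

(** * Controls, trajectories and the running cost *)

Lemma prim_indic (R : realType) (T : R) (S : set R) :
  measurable (S : set (measurableTypeR R)) -> S `<=` `[0, T]%classic ->
  (prim \1_S T)%:E = @lebesgue_measure R S.
Proof.
move=> mS ST.
have muS : (@lebesgue_measure R S < +oo)%E.
  apply: (@le_lt_trans _ _ (@lebesgue_measure R `[0, T]%classic)).
    exact: le_outer_measure.
  have -> : @lebesgue_measure R `[0, T]%classic = if 0 < T then T%:E else 0%E.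
    by rewrite lebesgue_measure_itv/= lte_fin; case: ifP => // _; rewrite oppr0 adde0.
  by case: ifP => // _; rewrite ltry.
by rewrite /prim /Rintegral integral_indic// setIidl// fineK// ge0_fin_numE.
Qed.

Definition system (R : realType) (n N : nat) (A : 'I_N -> 'M[R]_n)
    (v : 'I_N -> R -> R) (i j : 'I_n) (t : R) : R :=
  \sum_k v k t * A k i j.

Definition abs_entry_sum (R : realType) (n N : nat) (A : 'I_N -> 'M[R]_n) : R :=
  \sum_k \sum_i \sum_j `|A k i j|.

Lemma abs_entry_sum_ge0 (R : realType) (n N : nat) (A : 'I_N -> 'M[R]_n) :
  0 <= abs_entry_sum A.
Proof. by do 3!(apply: sumr_ge0 => ? _). Qed.

Lemma entry_le_abs_entry_sum (R : realType) (n N : nat) (A : 'I_N -> 'M[R]_n) k i j :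
  `|A k i j| <= abs_entry_sum A.
Proof.
apply: (le_trans (entry_le (A k) i j)); rewrite /abs_entry_sum (bigD1 k)//= lerDl.
by apply: sumr_ge0 => ? _; apply: sumr_ge0 => ? _; exact: sumr_ge0.
Qed.

Lemma system_le (R : realType) (n N : nat) (A : 'I_N -> 'M[R]_n)
    (v : 'I_N -> R -> R) i j t :
  (forall k, 0 <= v k t <= 1) -> `|system A v i j t| <= abs_entry_sum A.
Proof.
move=> hv; apply: (le_trans (ler_norm_sum _ _ _)); apply: ler_sum => k _.
have /andP[v0 v1] := hv k.
by rewrite normrM ger0_norm// -[leRHS]mul1r ler_pM// entry_le.
Qed.

Lemma system_meas (R : realType) (n N : nat) (A : 'I_N -> 'M[R]_n)
    (v : 'I_N -> R -> R) i j :
  (forall k, measurable_fun setT (v k : measurableTypeR R -> R)) ->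
  measurable_fun setT (system A v i j : measurableTypeR R -> R).
Proof.
move=> mv; apply: measurable_sum => k.
by apply: measurable_funM => //; exact: measurable_cst.
Qed.

Lemma PhiE (R : realType) (n N : nat) (A : 'I_N -> 'M[R]_n) (x : 'cV[R]_n)
    (u : 'cV[R]_N) i :
  (Phi A x *m u) i 0 = \sum_j (\sum_k u k 0 * A k i j) * x j 0.
Proof.
rewrite mxE; under eq_bigr do rewrite !mxE mulr_suml.
rewrite exchange_big/=; apply: eq_bigr => j _; rewrite mulr_suml.
by apply: eq_bigr => k _; ring.
Qed.

Lemma control_trajectory (R : realType) (n N : nat) (T : R)
    (A : 'I_N -> 'M[R]_n) (xi : 'cV[R]_n) (v : 'I_N -> R -> R) :
  0 <= T ->
  (forall k, measurable_fun setT (v k : measurableTypeR R -> R)) ->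
  (forall k t, 0 <= v k t <= 1) ->
  exists y : 'I_n -> R -> R,
  [/\ forall i, lip 0 T (y i), forall i, y i 0 = xi i 0,
      \forall t \ae (@lebesgue_measure R), 0 <= t <= T ->
        forall i, der (y i) t (\sum_j system A v i j t * y j t) &
      trajectory T A xi (fun t => \col_k v k t) (fun t => \col_i y i t)].
Proof.
move=> T0 mv v01.
have [y [ly y0 dy]] := @linear_ode R n T (abs_entry_sum A) (system A v) (fun i => xi i 0) T0
  (fun i j => system_meas A i j mv) (fun i j t => system_le A i j (v01 ^~ t)).
exists y; split => //; split; first exact: lip_col.
- by apply/colP => i; rewrite mxE.
apply/ae_completedE; apply: filterS dy => t h tT.
apply: is_derive_col => i; rewrite PhiE.
have -> : \sum_j (\sum_k (\col_k v k t) k 0 * A k i j) * (\col_i y i t) j 0 =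
    \sum_j system A v i j t * y j t.
  apply: eq_bigr => j _; rewrite mxE; congr (_ * _).
  by apply: eq_bigr => k _; rewrite mxE.
exact: h.
Qed.

Lemma borel_feasible (R : realType) (N : nat) (T : R) (v : 'I_N -> R -> R) :
  (forall k, measurable_fun setT (v k : measurableTypeR R -> R)) ->
  (forall k t, 0 <= v k t <= 1) ->
  (\forall t \ae (@lebesgue_measure R), 0 <= t <= T -> \sum_k v k t = 1) ->
  feasible T (fun t => \col_k v k t).
Proof.
move=> mv v01 v1; split.
  move=> k; have -> : (fun t => (\col_k v k t) k 0) = v k by apply/funext => t; rewrite mxE.
  by apply: borel_fun_completed => //; exact: measurable_itv.
apply/ae_completedE; apply: filterS v1 => t /[apply] h; split.
  by move=> k; rewrite mxE.
by rewrite -h; apply: eq_bigr => k _; rewrite mxE.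
Qed.

(** The Borel version takes values in [0, 1] at every time, not only almost
    every time, as the existence theorem for trajectories requires. *)
Lemma borel_control (R : realType) (N : nat) (T : R) (u : R -> 'cV[R]_N) :
  feasible T u ->
  exists ut : 'I_N -> R -> R,
  [/\ forall k, measurable_fun setT (ut k : measurableTypeR R -> R),
      forall k t, 0 <= ut k t <= 1 &
      \forall t \ae (@lebesgue_measure R), 0 <= t <= T ->
        (forall k, ut k t = u t k 0) /\ \sum_k ut k t = 1].
Proof.
move=> [mu_ /ae_completedE uU].
have mD : measurable (`[0, T]%classic : set (measurableTypeR R)) by exact: measurable_itv.
have /choice[ut hut] : forall k, exists g : R -> R,
    [/\ measurable_fun setT (g : measurableTypeR R -> R), forall t, 0 <= g t <= 1 &
    \forall t \ae (@lebesgue_measure R),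
      `[0, T]%classic t -> 0 <= u t k 0 <= 1 -> g t = u t k 0].
  by move=> k; have [g [mg g01] hg] := borel_version mD (mu_ k); exists g.
exists ut; split; [by move=> k; have [] := hut k|by move=> k; have [] := hut k|].
have : \forall t \ae (@lebesgue_measure R), forall k,
    `[0, T]%classic t -> 0 <= u t k 0 <= 1 -> ut k t = u t k 0.
  by apply: filter_forall => k; have [] := hut k.
apply: filterS2 uU => t hU hk tT; have [u01 u1] := hU tT.
have E k : ut k t = u t k 0 by apply: hk => //=; rewrite in_itv.
by split => //; rewrite -u1; apply: eq_bigr => k _.
Qed.

Lemma trajectory_components (R : realType) (n N : nat) (T : R)
    (A : 'I_N -> 'M[R]_n) (xi : 'cV[R]_n) (u : R -> 'cV[R]_N) (x : R -> 'cV[R]_n)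
    (ut : 'I_N -> R -> R) :
  0 <= T -> trajectory T A xi u x -> (forall k t, 0 <= ut k t <= 1) ->
  (\forall t \ae (@lebesgue_measure R), 0 <= t <= T -> forall k, ut k t = u t k 0) ->
  (forall i, lip 0 T (fun t => x t i 0)) /\
  \forall t \ae (@lebesgue_measure R), 0 <= t <= T ->
    forall i, der (fun s => x s i 0) t (\sum_j system A ut i j t * x t j 0).
Proof.
move=> T0 [acx x0 /ae_completedE dx] u01 uu.
have dxi : \forall t \ae (@lebesgue_measure R), 0 <= t <= T ->
    forall i, der (fun s => x s i 0) t (\sum_j system A ut i j t * x t j 0).
  apply: filterS2 dx uu => t h1 h2 tT i.
  have := is_derive_entry i (h1 tT); rewrite PhiE.
  congr (is_derive _ _ _ _); apply: eq_bigr => j _; congr (_ * _).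
  by apply: eq_bigr => k _; rewrite h2.
split=> // i.
have [X X0 hX] := uniform_bound (P := fun t => 0 <= t <= T) (f := fun i t => x t i 0)
  (fun i => ac_bounded T0 (ac_entry i acx)).
apply: (@ac_der_lip R T (n%:R * (abs_entry_sum A * X))).
- by rewrite !mulr_ge0// abs_entry_sum_ge0.
- exact: ac_entry.
apply: filterS dxi => t h tT; exists (\sum_j system A ut i j t * x t j 0); first exact: h.
apply: (le_trans (ler_norm_sum _ _ _)); rewrite -sumr_cst_ord; apply: ler_sum => j _.
by rewrite normrM ler_pM// ?system_le// hX.
Qed.

Lemma quadE (R : realType) (n : nat) (Q : 'M[R]_n) (x : 'cV[R]_n) :
  (x^T *m Q *m x) 0 0 = \sum_i \sum_j x i 0 * Q i j * x j 0.
Proof.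
rewrite mxE; under eq_bigr do rewrite !mxE mulr_suml.
rewrite exchange_big/=; apply: eq_bigr => i _; apply: eq_bigr => j _.
by rewrite mxE.
Qed.

Section running_cost.
Variables (R : realType) (N : nat) (psi : 'cV[R]_N -> R) (psi_ : 'I_N -> R -> R).
Hypothesis hpsi_meas : forall i, measurable_fun [set: R] (psi_ i).
Hypothesis hpsi : forall u : 'cV[R]_N, psi u = \sum_(i < N) psi_ i (u i 0).
Hypothesis hpsi01 : forall i, psi_ i 0 = 0 /\ psi_ i 1 = 0.
Hypothesis hpsi_pos : forall i (s : R), 0 < s < 1 -> 0 < psi_ i s.

Lemma psi_i_ge0 i s : 0 <= s <= 1 -> 0 <= psi_ i s.
Proof.
have [p0 p1] := hpsi01 i.
move=> /andP[]; rewrite le_eqVlt => /predU1P[<-|s0]; first by rewrite p0.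
rewrite le_eqVlt => /predU1P[->|s1]; first by rewrite p1.
by apply/ltW/hpsi_pos; rewrite s0.
Qed.

Definition running (v : 'I_N -> R -> R) (t : R) : R := \sum_k psi_ k (v k t).

Lemma running_ge0 v t : (forall k, 0 <= v k t <= 1) -> 0 <= running v t.
Proof. by move=> hv; apply: sumr_ge0 => k _; exact: psi_i_ge0. Qed.

Lemma running_meas v : (forall k, measurable_fun setT (v k : measurableTypeR R -> R)) ->
  measurable_fun setT (running v : measurableTypeR R -> R).
Proof. by move=> mv; apply: measurable_sum => k; exact: measurableT_comp. Qed.

Lemma running_vertex v (k0 : 'I_N) t :
  (forall k, v k t = (k == k0)%:R) -> running v t = 0.
Proof.
move=> hv; rewrite /running big1// => k _; rewrite hv; have [p0 p1] := hpsi01 k.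
by case: (k == k0).
Qed.

Lemma running_gt0 v t :
  (forall k, 0 <= v k t <= 1) -> ~ (forall k, v k t = 0 \/ v k t = 1) -> 0 < running v t.
Proof.
move=> v01 /existsNP[k /not_orP[/eqP k0 /eqP k1]].
rewrite /running (bigD1 k)//= ltr_pwDl ?sumr_ge0//; last by move=> j _; exact: psi_i_ge0.
have /andP[h0 h1] := v01 k.
by apply: hpsi_pos; rewrite !lt_neqAle h0 h1 eq_sym k0 k1.
Qed.

Lemma running_cost_borel (T : R) (u : R -> 'cV[R]_N) (ut : 'I_N -> R -> R) :
  feasible T u -> (forall k, measurable_fun setT (ut k : measurableTypeR R -> R)) ->
  (\forall t \ae (@lebesgue_measure R), 0 <= t <= T -> forall k, ut k t = u t k 0) ->
  (\int[@completed_lebesgue_measure R]_(t in `[0%R, T]) (psi (u t))%:E =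
   \int[@completed_lebesgue_measure R]_(t in `[0%R, T]) (running ut t)%:E)%E.
Proof.
move=> [mu_ _] mut uu.
have mD : measurable (`[0, T]%classic : set (measurableTypeR R)) by exact: measurable_itv.
apply: ae_eq_integral.
- exact: borel_completed_measurable.
- apply/measurable_EFinP.
  have -> : (fun t => psi (u t)) = fun t => \sum_k psi_ k (u t k 0).
    by apply/funext => t; exact: hpsi.
  by apply: measurable_sum => k; exact: measurableT_comp.
- apply/measurable_EFinP; apply: borel_fun_completed => //; exact: running_meas.
apply/ae_completedE; apply: filterS uu => t h tT; congr _%:E.
by rewrite hpsi; apply: eq_bigr => k _; rewrite h.
Qed.

End running_cost.

Lemma integral_drop (R : realType) (T c : R) (S : set R) (f g : R -> R) :
  measurable (S : set (measurableTypeR R)) -> S `<=` `[0, T]%classic -> 0 <= c ->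
  measurable_fun setT (f : measurableTypeR R -> R) ->
  measurable_fun setT (g : measurableTypeR R -> R) ->
  (forall t, 0 <= g t) ->
  (forall t, g t + c * \1_S t <= f t) ->
  (\int[@completed_lebesgue_measure R]_(t in `[0%R, T]) (g t)%:E + (c * prim \1_S T)%:E <=
   \int[@completed_lebesgue_measure R]_(t in `[0%R, T]) (f t)%:E)%E.
Proof.
move=> mS ST c0 mf mg g0 gf.
have mD : measurable (`[0, T]%classic : set (measurableTypeR R)) by exact: measurable_itv.
have mDc := borel_completed_measurable mD.
have mSc := borel_completed_measurable mS.
have mgc := borel_fun_completed mD mg.
have mcS : measurable_fun (`[0, T]%classic : set (lebesgueTypeR R))
    (fun t : lebesgueTypeR R => c * \1_S t : R).
  apply: borel_fun_completed => //; apply: measurable_funM; first exact: measurable_cst.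
  exact: measurable_indic.
have -> : (c * prim \1_S T)%:E =
    (\int[@completed_lebesgue_measure R]_(t in `[0%R, T]) (c * \1_S t)%:E)%E.
  rewrite EFinM (prim_indic mS ST); apply/esym.
  rewrite (integralZl_indic mDc (fun=> S))//; last by rewrite ltNge c0.
  rewrite (integral_indic _ mDc mSc) setIidl//.
rewrite -(ge0_integralD _ mDc); last 4 first.
- by move=> t _; rewrite lee_fin.
- exact/measurable_EFinP.
- by move=> t _; rewrite lee_fin mulr_ge0// indicE.
- exact/measurable_EFinP.
apply: (ge0_le_integral _ mDc).
- by move=> t _; rewrite -EFinD lee_fin addr_ge0// mulr_ge0// indicE.
- by apply: emeasurable_funD; apply/measurable_EFinP.
- by apply/measurable_EFinP; exact: borel_fun_completed.
- by move=> t _; rewrite -EFinD lee_fin.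
Qed.

(** * Switching to a vertex, and the theorem *)

Lemma measurable_sublevel (R : realType) (f : R -> R) (a : R) :
  measurable_fun setT (f : measurableTypeR R -> R) ->
  measurable ([set t | f t <= a] : set (measurableTypeR R)).
Proof.
move=> mf; have := mf measurableT `]-oo, a]%classic (measurable_itv _).
by rewrite setTI; congr measurable; apply/seteqP; split => t /=; rewrite in_itv.
Qed.

Lemma optimal_cost_fin (R : realType) (l a b : R) (I J : \bar R) :
  0 < l -> (0 <= I)%E -> J \is a fin_num ->
  (a%:E + l%:E * I <= b%:E + l%:E * J)%E -> I \is a fin_num.
Proof.
move=> l0; case: I => [r||]//= _; case: J => [s||]//= _.
by rewrite gt0_muley ?lte_fin// addey// leye_eq.
Qed.

(** The saving [l * c * d] on the running cost cannot exceed the loss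
    [C * d ^ 2] on the terminal cost. Finiteness of [I] is needed: otherwise
    both costs could be infinite and nothing would follow. *)
Lemma needle_balance (R : realType) (l c d C qx qy : R) (I J : \bar R) :
  0 < l -> 0 < d -> I \is a fin_num -> (0 <= J)%E ->
  (J + (c * d)%:E <= I)%E ->
  (qx%:E + l%:E * I <= qy%:E + l%:E * J)%E -> qy <= qx + C * d ^+ 2 ->
  l * c <= C * d.
Proof.
move=> l0 d0; case: I => // a _; case: J => [e||]// _.
rewrite -EFinD -!EFinM -!EFinD !lee_fin => drop cmp quad.
have h1 : l * (e + c * d) <= l * a by rewrite ler_wpM2l// ltW.
have E2 : C * d ^+ 2 = C * d * d by ring.
by rewrite -(ler_pM2r d0); lra.
Qed.

Section switch.
Variables (R : realType) (n N : nat) (A : 'I_N -> 'M[R]_n).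

(** Written with the indicator function, so that the matrix of the controlled
    system is affine in it ([switched_system]). *)
Definition switched (S : set R) (k0 : 'I_N) (v : 'I_N -> R -> R) (k : 'I_N) (t : R) : R :=
  \1_S t * (k == k0)%:R + (1 - \1_S t) * v k t.

Lemma switched_in S k0 v k t : S t -> switched S k0 v k t = (k == k0)%:R.
Proof. by move=> St; rewrite /switched indicE mem_set// subrr mul0r mul1r addr0. Qed.

Lemma switched_out S k0 v k t : ~ S t -> switched S k0 v k t = v k t.
Proof. by move=> St; rewrite /switched indicE memNset// subr0 mul0r mul1r add0r. Qed.

Lemma switched_meas S k0 v k : measurable (S : set (measurableTypeR R)) ->
  measurable_fun setT (v k : measurableTypeR R -> R) ->
  measurable_fun setT (switched S k0 v k : measurableTypeR R -> R).
Proof.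
move=> mS mv; have m1 : measurable_fun setT (\1_S : measurableTypeR R -> R).
  exact: measurable_indic.
by apply: measurable_funD; apply: measurable_funM => //; exact: measurable_funB.
Qed.

Lemma switched_itv S k0 v k t : 0 <= v k t <= 1 -> 0 <= switched S k0 v k t <= 1.
Proof.
move=> hv; have [St|St] := pselect (S t); last by rewrite switched_out.
by rewrite switched_in//; case: eqP => _; rewrite ?lexx ?ler01.
Qed.

Lemma sum_vertex (F : 'I_N -> R) (k0 : 'I_N) : \sum_k (k == k0)%:R * F k = F k0.
Proof.
rewrite (bigD1 k0)//= eqxx mul1r big1 ?addr0// => k kk0.
by rewrite (negbTE kk0) mul0r.
Qed.

Lemma switched_sum S k0 v t : \sum_k v k t = 1 -> \sum_k switched S k0 v k t = 1.
Proof.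
move=> v1; rewrite big_split/= -!mulr_sumr v1.
have -> : \sum_k (k == k0)%:R = 1 :> R.
  by have := sum_vertex (fun=> 1) k0; under eq_bigr do rewrite mulr1.
by ring.
Qed.

Lemma switched_system S k0 v i j t :
  system A (switched S k0 v) i j t =
  system A v i j t + \1_S t * (A k0 i j - system A v i j t).
Proof.
rewrite /system /switched; under eq_bigr do rewrite mulrDl -!mulrA.
by rewrite big_split/= -!mulr_sumr (sum_vertex (fun k => A k i j)); ring.
Qed.

(** The weighted sum of these quantities over [k], with weights [v k t], is zero. *)
Lemma some_switch_le0 (v : 'I_N -> R -> R) (p x : 'I_n -> R) t :
  (forall k, 0 <= v k t) -> \sum_k v k t = 1 ->
  exists k, \sum_i \sum_j p i * (A k i j - system A v i j t) * x j <= 0.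
Proof.
move=> v0 v1; apply: contrapT => /forallNP H.
have {}H k : 0 < \sum_i \sum_j p i * (A k i j - system A v i j t) * x j.
  by rewrite ltNge; apply/negP.
have : \sum_k v k t * (\sum_i \sum_j p i * (A k i j - system A v i j t) * x j) = 0.
  under eq_bigr do rewrite mulr_sumr; rewrite exchange_big/= big1// => i _.
  under eq_bigr do rewrite mulr_sumr; rewrite exchange_big/= big1// => j _.
  transitivity (p i * x j * (\sum_k v k t * A k i j - system A v i j t * \sum_k v k t)).
    by rewrite mulrBr !mulr_sumr -sumrB; apply: eq_bigr => k _; ring.
  by rewrite v1 mulr1 subrr mulr0.
move/psumr_eq0P => h.
suff : \sum_k v k t = 0 by rewrite v1 => /eqP; rewrite oner_eq0.
rewrite big1// => k _; have /eqP := h (fun k _ => mulr_ge0 (v0 k) (ltW (H k))) k isT.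
by rewrite mulf_eq0 (gt_eqF (H k)) orbF => /eqP.
Qed.

End switch.

Lemma prim_indic_bounds (R : realType) (T : R) (S : set R) :
  0 <= T -> measurable (S : set (measurableTypeR R)) ->
  forall t, 0 <= t <= T -> 0 <= prim \1_S t <= prim \1_S T.
Proof.
move=> T0 mS t /andP[t0 tT].
have a1 := bounded_borel_indic mS.
have mono s r : 0 <= s -> s <= r -> r <= T -> prim \1_S s <= prim \1_S r.
  move=> s0 sr rT.
  have := @lip_le R T (fun=> 0) (prim \1_S) (lip_cst _ _ _)
    (bounded_borel_prim_lip T a1) _ s r s0 sr rT.
  rewrite subrr subr_ge0; apply; apply: filterS (bounded_borel_prim_der a1) => z h /andP[z0 _].
  by exists 0, (\1_S z); split; [exact: der_cst|exact: h|rewrite indicE].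
by rewrite -{1}(@prim_le0 _ \1_S 0)// !mono.
Qed.

Theorem lemma2 (R : realType) (n N : nat) (hn : (1 <= n)%N) (hN : (1 <= N)%N)
    (T lambda : R) (hT : 0 < T) (hlambda : 0 < lambda)
    (xi : 'cV[R]_n) (A : 'I_N -> 'M[R]_n)
    (Q : 'M[R]_n) (hQ : posdefmx Q)
    (psi : 'cV[R]_N -> R) (psi_ : 'I_N -> R -> R)
    (hpsi_meas : forall i, measurable_fun [set: R] (psi_ i))
    (hpsi : forall u : 'cV[R]_N, psi u = \sum_(i < N) psi_ i (u i 0))
    (hpsi01 : forall i, psi_ i 0 = 0 /\ psi_ i 1 = 0)
    (hpsi_pos : forall i (s : R), 0 < s < 1 -> 0 < psi_ i s)
    (u : R -> 'cV[R]_N) (hu : optimal T lambda xi A Q psi u) :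
  \forall t \ae (@completed_lebesgue_measure R), 0 <= t <= T ->
    (forall i, u t i 0 = 0 \/ u t i 0 = 1) /\ \sum_(i < N) u t i 0 = 1.
Proof.
have T0 := ltW hT; have [feas [x traj opt]] := hu.
(* From here on [u] is represented by the Borel control [ut]. *)
have [ut [mut ut01 utu]] := borel_control feas.
have uteq : \forall t \ae (@lebesgue_measure R), 0 <= t <= T -> forall k, ut k t = u t k 0.
  by apply: filterS utu => t h tT k; have [] := h tT.
have [lx dx] := trajectory_components T0 traj ut01 uteq.
pose b := system A ut.
have mb i j : measurable_fun setT (b i j : measurableTypeR R -> R) by exact: system_meas.
have bM i j t : `|b i j t| <= abs_entry_sum A by exact: system_le.
have [p [lp pT dp]] := @adjoint_ode R n T (abs_entry_sum A) b
  (fun i => \sum_j (Q i j + Q j i) * x T j 0) T0 mb bM.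
have M0 := abs_entry_sum_ge0 A.
have [C hC] := @needle_variation R n T _ _ Q b (fun i t => x t i 0) p T0
  M0 (addr_ge0 M0 M0) lx lp bM dx dp pT.
pose w k i j t := A k i j - b i j t.
(* First-order effect on the terminal cost of switching to the vertex [k] at time
   [t]; [clamp] makes it a Borel function on the line. *)
pose sw k t := \sum_i \sum_j p i (clamp T t) * w k i j t * x (clamp T t) j 0.
have wW k i j t : `|w k i j t| <= abs_entry_sum A + abs_entry_sum A.
  by rewrite (le_trans (ler_normB _ _))// lerD// entry_le_abs_entry_sum.
have msw k : measurable_fun setT (sw k : measurableTypeR R -> R).
  suff [] : bounded_borel (sw k) by [].
  apply: bounded_borel_sum => i; apply: bounded_borel_sum => j.
  apply: bounded_borelM; last exact: (bounded_borel_clamp T0 (lx j)).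
  apply: bounded_borelM; first exact: bounded_borel_clamp.
  split; last by exists (abs_entry_sum A + abs_entry_sum A).
  by apply: measurable_funB => //; exact: measurable_cst.
have costE := running_cost_borel hpsi_meas hpsi.
pose I := (\int[@completed_lebesgue_measure R]_(t in `[0%R, T]) (running psi_ ut t)%:E)%E.
have run_ge0 v t : (forall k, 0 <= v k t <= 1) -> 0 <= running psi_ v t.
  exact: running_ge0.
have I0 : (0 <= I)%E by apply: integral_ge0 => t _; rewrite lee_fin run_ge0.
have mrun := running_meas hpsi_meas.
have compare v y : (forall k, measurable_fun setT (v k : measurableTypeR R -> R)) ->
    (forall k t, 0 <= v k t <= 1) ->
    (\forall t \ae (@lebesgue_measure R), 0 <= t <= T -> \sum_k v k t = 1) ->
    trajectory T A xi (fun t => \col_k v k t) (fun t => \col_i y i t) ->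
    ((\sum_i \sum_j x T i 0 * Q i j * x T j 0)%:E + lambda%:E * I <=
     (\sum_i \sum_j y i T * Q i j * y j T)%:E + lambda%:E *
     \int[@completed_lebesgue_measure R]_(t in `[0%R, T]) (running psi_ v t)%:E)%E.
  move=> mv v01 v1 ty; have fv := borel_feasible mv v01 v1.
  have := opt _ _ fv ty; rewrite /cost (costE _ _ ut)// (costE _ _ v)//; last first.
    by apply: aeW => t _ k; rewrite mxE.
  rewrite !quadE; congr (_ <= _ + _)%E; congr _%:E.
  by apply: eq_bigr => i _; apply: eq_bigr => j _; rewrite !mxE.
have Ifin : I \is a fin_num.
  (* A constant vertex control has zero running cost, so the optimal running
     cost is finite. *)
  pose k0 := Ordinal hN.
  pose v (k : 'I_N) (t : R) : R := (k == k0)%:R.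
  have mv k : measurable_fun setT (v k : measurableTypeR R -> R) by exact: measurable_cst.
  have v01 k t : 0 <= v k t <= 1 by rewrite /v; case: eqP; rewrite ?lexx ler01.
  have [y [_ _ _ ty]] := control_trajectory A xi T0 mv v01.
  have J0 : (\int[@completed_lebesgue_measure R]_(t in `[0%R, T]) (running psi_ v t)%:E = 0)%E.
    by apply: integral0_eq => t _; rewrite (running_vertex hpsi01 (k0 := k0)).
  have v1 : \forall t \ae (@lebesgue_measure R), 0 <= t <= T -> \sum_k v k t = 1.
    apply: aeW => t _; have := sum_vertex (fun=> 1 : R) k0.
    by under eq_bigr do rewrite mulr1.
  have := compare v y mv v01 v1 ty; rewrite J0; exact: optimal_cost_fin.
have null_needle k c (S : set R) : 0 < c -> measurable (S : set (measurableTypeR R)) ->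
    S `<=` `[0, T]%classic ->
    (forall t, S t -> c <= running psi_ ut t /\ sw k t <= 0) ->
    C * prim \1_S T < lambda * c -> @lebesgue_measure R S = 0%E.
  move=> c0 mS ST hS small; rewrite -(prim_indic mS ST); congr _%:E.
  apply: contrapT => /eqP d_neq0.
  have bnd := prim_indic_bounds T0 mS.
  set delta := prim \1_S T in small d_neq0 bnd.
  have d0 : 0 < delta.
    by rewrite lt_neqAle eq_sym d_neq0; have /andP[] := bnd T ltac:(by rewrite T0 lexx).
  pose v := switched S k ut.
  have mv k' : measurable_fun setT (v k' : measurableTypeR R -> R) by exact: switched_meas.
  have v01 k' t : 0 <= v k' t <= 1 by exact: switched_itv.
  have v1 : \forall t \ae (@lebesgue_measure R), 0 <= t <= T -> \sum_k v k t = 1.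
    by apply: filterS utu => t h tT; apply: switched_sum; have [] := h tT.
  have [y [ly y0 dy ty]] := control_trajectory A xi T0 mv v01.
  have a1 := bounded_borel_indic mS.
  have quad := hC delta \1_S (prim \1_S) (w k) y d0 (bounded_borel_prim_lip T a1)
    (prim_le0 _ (lexx 0)) bnd _ (wW k) ly _ _ (bounded_borel_prim_der a1).
  have {}quad : \sum_i \sum_j y i T * Q i j * y j T <=
      \sum_i \sum_j x T i 0 * Q i j * x T j 0 + C * delta ^+ 2.
    apply: quad.
    - by move=> t; rewrite indicE; case: (t \in S); rewrite ?lexx ler01.
    - by move=> i; rewrite y0; case: traj => _ ->.
    - move=> t tT; rewrite indicE; have [/set_mem St|_] := boolP (t \in S); last by rewrite mul0r.
      by have [_] := hS t St; rewrite mul1r /sw clamp_id.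
    - apply: filterS dy => t h tT i; have := h tT i; congr (is_derive _ _ _ _).
      by apply: eq_bigr => j _; rewrite switched_system.
  have drop := @integral_drop R T c S (running psi_ ut) (running psi_ v) mS ST (ltW c0)
    (mrun _ mut) (mrun _ mv) (fun t => run_ge0 v t (v01 ^~ t)).
  have {}drop : (\int[@completed_lebesgue_measure R]_(t in `[0%R, T]) (running psi_ v t)%:E +
      (c * delta)%:E <= I)%E.
    apply: drop => t; have [St|St] := pselect (S t).
      rewrite indicE mem_set// mulr1.
      rewrite (running_vertex hpsi01 (k0 := k)) ?add0r; first by have [] := hS t St.
      by move=> k'; exact: switched_in.
    rewrite indicE memNset// mulr0 addr0 le_eqVlt; apply/orP; left; apply/eqP.
    by apply: eq_bigr => k' _; rewrite /v switched_out.
  have := compare v y mv v01 v1 ty.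
  have J0 : (0 <= \int[@completed_lebesgue_measure R]_(t in `[0%R, T]) (running psi_ v t)%:E)%E.
    by apply: integral_ge0 => t _; rewrite lee_fin run_ge0.
  move=> cmp; have := needle_balance hlambda d0 Ifin J0 drop cmp quad.
  by rewrite leNgt small.
pose c (m : nat) : R := m.+1%:R^-1.
have c_gt0 m : 0 < c m by rewrite invr_gt0.
(* Short enough for [C * delta < lambda * c m] to hold whenever [delta <= eta m]. *)
pose eta m : R := lambda * c m / (`|C| + 1).
have eta_gt0 m : 0 < eta m by rewrite divr_gt0 ?mulr_gt0// ltr_pwDr.
(* Times in the [r]-th interval of length [eta m] at which the running cost is
   at least [c m] and switching to [k] does not increase the terminal cost to
   first order. *)
pose piece k m (r : nat) : set R := [set` `[r%:R * eta m, r.+1%:R * eta m]] `&`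
  (`[0, T]%classic `&` ([set t | - running psi_ ut t <= - c m] `&` [set t | sw k t <= 0])).
have piece_null k m r : @lebesgue_measure R (piece k m r) = 0%E.
  have mP : measurable (piece k m r : set (measurableTypeR R)).
    apply: measurableI; first exact: measurable_itv.
    apply: measurableI; first exact: measurable_itv.
    apply: measurableI; apply: measurable_sublevel => //.
    by apply: measurableT_comp => //; exact: mrun.
  have PT : piece k m r `<=` `[0, T]%classic by move=> t [_ []].
  apply: (null_needle k (c m)) => //.
    by move=> t [_ [_ [/=]]]; rewrite lerN2.
  have small : prim \1_(piece k m r) T <= eta m.
    rewrite -lee_fin (prim_indic mP PT).
    apply: (@le_trans _ _ (@lebesgue_measure R [set` `[r%:R * eta m, r.+1%:R * eta m]])).
      by apply: le_outer_measure; exact: subIsetl.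
    have -> : @lebesgue_measure R [set` `[r%:R * eta m, r.+1%:R * eta m]] = (eta m)%:E.
      rewrite lebesgue_measure_itv/= lte_fin ltr_pM2r// ltr_nat ltnSn -EFinB.
      by congr _%:E; rewrite -mulrBl -natrB// subSnn mul1r.
    by [].
  have d0 : 0 <= prim \1_(piece k m r) T.
    by have /andP[] := prim_indic_bounds T0 mP (t := T) ltac:(by rewrite T0 lexx).
  have : (`|C| + 1) * eta m = lambda * c m.
    by rewrite /eta mulrC mulfVK// gt_eqF// ltr_pwDr.
  have : C * prim \1_(piece k m r) T <= `|C| * eta m.
    by apply: le_trans (ler_wpM2r d0 (ler_norm C)) _; rewrite ler_wpM2l.
  by have := eta_gt0 m; lra.
have ae_piece : \forall t \ae (@lebesgue_measure R), forall k m r, ~ piece k m r t.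
  apply: filter_forall => k; apply: ae_foralln => m; apply: ae_foralln => r.
  exists (piece k m r); split; [|exact: piece_null|by move=> t /= /contrapT].
  apply: measurableI; first exact: measurable_itv.
  apply: measurableI; first exact: measurable_itv.
  apply: measurableI; apply: measurable_sublevel => //.
  by apply: measurableT_comp => //; exact: mrun.
apply/ae_completedE; apply: filterS2 ae_piece utu => t hpiece hut tT.
have [ute ut1] := hut tT.
split; last by rewrite -ut1; apply: eq_bigr => k _.
apply: contrapT => nv.
have run0 : 0 < running psi_ ut t.
  apply: running_gt0 => // h; apply: nv => k; rewrite -ute; exact: h.
have ut_ge0 k : 0 <= ut k t by have /andP[] := ut01 k t.
have [k swk] := some_switch_le0 A (p ^~ t) (fun j => x t j 0) ut_ge0 ut1.
have runV : 0 < (running psi_ ut t)^-1 by rewrite invr_gt0.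
pose m := Num.trunc ((running psi_ ut t)^-1).
have cm : c m <= running psi_ ut t.
  have /andP[_ /ltW h] := truncn_itv (ltW runV).
  by rewrite /c invf_ple// posrE.
have t0 : 0 <= t / eta m by apply: divr_ge0; [case/andP: tT|exact: ltW].
have /andP[r1 r2] := truncn_itv t0.
apply: (hpiece k m (Num.trunc (t / eta m))); split.
  by rewrite /= in_itv/= -ler_pdivlMr// r1 -ler_pdivrMr//= ltW.
split; first by rewrite /= in_itv.
by split => /=; [rewrite lerN2|rewrite /sw clamp_id].
Qed.
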